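(* Let $\alpha_0>\alpha_1>\alpha_2>\cdots$ be the zeros of the Digamma function $\psi$. Then $$\sum_{k=0}^\infty\frac{1}{\alpha_k^2-\alpha_k}=\gamma+\frac{\pi^2}{6\gamma},$$ where $\gamma$ is the Euler constant.
   Context: $\psi(z)=\Gamma'(z)/\Gamma(z)$, $z\in\mathbb C\setminus\{0,-1,-2,\dots\}$, is the Digamma function, with $\Gamma$ the Euler gamma function. It is known that all zeros of $\psi$ are real and simple, and that all of them except one are negative; $\alpha_k$ denotes the $k$th zero counted from the right, so $\alpha_0=1.461632\dots$ is the unique positive zero. *)

(* Defs.v *)
From Stdlib Require Export Reals.
From Coquelicot Require Export Coquelicot.
Open Scope R_scope.

Definition Cexp (z : C) : C :=
  (exp (fst z) * cos (snd z), exp (fst z) * sin (snd z)).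

(* t ^ w for real t > 0, with the real logarithm of t. *)
Definition Rcpow (t : R) (w : C) : C := Cexp (w * RtoC (ln t))%C.

(* Euler's integral of the second kind; it converges when 0 < Re z. *)
Definition EulerIntegral (z : C) : C :=
  RInt_gen (V := C_R_CompleteNormedModule)
    (fun t : R => (Rcpow t (z - 1) * RtoC (exp (- t)))%C)
    (at_right 0) (Rbar_locally p_infty).

Fixpoint rising (z : C) (n : nat) : C :=
  match n with
  | O => RtoC 1
  | S m => (rising z m * (z + RtoC (INR m)))%C
  end.

(* The least n such that 0 < Re z + n; it is 0 when 0 < Re z, because
   [up x] is the unique integer in the interval ]x, x + 1]. *)
Definition shift (z : C) : nat := Z.to_nat (up (- fst z)).

(* Euler's integral for 0 < Re z, continued to the left by
   Gamma (z + 1) = z * Gamma z. The value at 0, -1, -2, ... is meaningless. *)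
Definition Gamma (z : C) : C :=
  (EulerIntegral (z + RtoC (INR (shift z))) / rising z (shift z))%C.

(* Gamma is holomorphic off its poles, so that Coquelicot's total operator
   [C_derive] gives its complex derivative there ([is_C_derive_unique]). *)
Definition Digamma (z : C) : C := (C_derive Gamma z / Gamma z)%C.

Definition Digamma_domain (z : C) : Prop :=
  forall n : nat, z <> RtoC (- INR n).

Definition is_Digamma_zero (z : C) : Prop :=
  Digamma_domain z /\ Digamma z = RtoC 0.

(* The limit of 1 + 1/2 + ... + 1/(n+1) - ln (n+1). *)
Definition EulerGamma : R :=
  real (Lim_seq (fun n => sum_n (fun k => / INR (S k)) n - ln (INR (S n)))).

(* Main.v *)
Require Import Defs.
From Stdlib Require Import Reals Ranalysis5 Znat Lra Lia Psatz.
From Coquelicot Require Import Coquelicot.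
Open Scope R_scope.

(** No complex analysis is needed: Coquelicot's [C_derive] at a real point is a
limit along the real line, so on the reals the Digamma function is the
logarithmic derivative of a real Gamma function. The bounds
psi(y) <= ln y <= psi(y + 1) and psi(y + 1) = psi(y) + 1/y then give
psi(x) = - gamma + sum_n (1/(n+1) - 1/(x+n)).

Instead of a Hadamard product, truncate this series after n = N. The resulting
rational function has exactly N + 1 zeros a_0 > 1 and -k < a_k < 1 - k
(1 <= k <= N), so its numerator is L prod (z - a_k), and comparing logarithmic
derivatives of the numerator at 0 and 1 gives
  sum_(k <= N) 1/(a_k^2 - a_k)
    = gamma - 2/(N+1) + (sum_(n <= N) 1/(n+1)^2) / gamma.
As N grows, each a_k tends to alpha_k and its term 1/(a_k^2 - a_k) approaches
that of alpha_k from below, so the limit may be taken termwise; the right-hand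
side converges by Basel. *)

(** * Improper integrals over the positive half-line *)

(** The points 0 and 1 come from the partial fraction 1/(a^2 - a) = 1/(0 - a) - 1/(1 - a). Both
    logarithmic derivatives can be computed because the truncation equals - gamma at 1 for every N
    and has a simple pole of residue -1 at 0. Each contains a harmonic number that diverges with N;
    these nearly cancel in the difference. The gamma in the denominator is the value at 1.

    The dropped terms (z - 1)/((n + 1)(z + n)) have the sign of z - 1 in the cells concerned, so
    truncating raises the series to the left of 1 and lowers it to the right. As the series
    increases between poles, truncating pushes its zeros away from [0, 1], where 1/(a^2 - a) is
    smaller. This sign is the only uniformity behind the exchange of limit and sum: it bounds the
    sum over the alpha_k from below, and convergence of finitely many zeros together with positivity
    of the rest bounds it from above. *)

Definition is_RInt_pos (f : R -> R) (l : R) : Prop :=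
  is_RInt_gen (V := R_NormedModule) f (at_right 0) (Rbar_locally p_infty) l.

Lemma filter_prod_pos (P : R * R -> Prop) :
  filter_prod (at_right 0) (Rbar_locally p_infty) P <->
  exists e M, 0 < e < M /\ forall a b, 0 < a < e -> M < b -> P (a, b).
Proof.
  split.
  - intros [Q S [d Hd] [M HM] H].
    exists (Rmin d 1), (Rmax M 2).
    assert (0 < d) by apply cond_pos.
    assert (0 < Rmin d 1) by (apply Rmin_glb_lt; lra).
    assert (Rmin d 1 <= 1) by apply Rmin_r.
    assert (Rmin d 1 <= d) by apply Rmin_l.
    assert (2 <= Rmax M 2) by apply Rmax_r.
    assert (M <= Rmax M 2) by apply Rmax_l.
    split. lra. intros a b Ha Hb. apply H.
    + apply Hd; [|tauto]. unfold ball; simpl.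
      unfold AbsRing_ball, abs, minus, plus, opp; simpl.
      rewrite Rabs_pos_eq; lra.
    + apply HM. lra.
  - intros (e & M & He & H).
    apply (Filter_prod _ _ _ (fun a => 0 < a < e) (fun b => M < b)).
    + exists (mkposreal e (proj1 He)). intros y Hy Hy0.
      unfold ball in Hy; simpl in Hy.
      unfold AbsRing_ball, abs, minus, plus, opp in Hy; simpl in Hy.
      rewrite Rabs_pos_eq in Hy; lra.
    + exists M. intros; assumption.
    + intros; now apply H.
Qed.

Lemma is_RInt_pos_spec (f : R -> R) (l : R) :
  is_RInt_pos f l <->
  forall eps, 0 < eps -> exists e M, 0 < e < M /\
    forall a b, 0 < a < e -> M < b ->
    exists y, is_RInt f a b y /\ Rabs (y - l) < eps.
Proof.
  split.
  - intros H eps Heps.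
    specialize (H (fun y => Rabs (y - l) < eps)).
    assert (L : locally l (fun y : R_NormedModule => Rabs (y - l) < eps)).
    { exists (mkposreal eps Heps). intros y Hy. exact Hy. }
    destruct (proj1 (filter_prod_pos _) (H L)) as (e & M & He & HH).
    exists e, M; split; [exact He|exact HH].
  - intros H P [eps HP].
    apply filter_prod_pos.
    destruct (H eps (cond_pos eps)) as (e & M & He & HH).
    exists e, M; split; [exact He|]. intros a b Ha Hb.
    destruct (HH a b Ha Hb) as (y & Hy1 & Hy2). exists y; split; auto.
Qed.

Lemma is_RInt_pos_ext (f g : R -> R) (l : R) :
  (forall t, 0 < t -> f t = g t) -> is_RInt_pos f l -> is_RInt_pos g l.
Proof.
  intros E H. apply is_RInt_pos_spec. intros eps Heps.
  destruct (proj1 (is_RInt_pos_spec _ _) H eps Heps) as (e & M & He & HH).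
  exists e, M; split; [exact He|]. intros a b Ha Hb.
  destruct (HH a b Ha Hb) as (y & Hy1 & Hy2). exists y; split; auto.
  apply (is_RInt_ext f); auto. intros t [Ht _]. apply E.
  rewrite Rmin_left in Ht; lra.
Qed.

Lemma is_RInt_pos_plus (f g : R -> R) (lf lg : R) :
  is_RInt_pos f lf -> is_RInt_pos g lg ->
  is_RInt_pos (fun t => f t + g t) (lf + lg).
Proof. intros Hf Hg. exact (is_RInt_gen_plus _ _ _ _ Hf Hg). Qed.

Lemma is_RInt_pos_minus (f g : R -> R) (lf lg : R) :
  is_RInt_pos f lf -> is_RInt_pos g lg ->
  is_RInt_pos (fun t => f t - g t) (lf - lg).
Proof. intros Hf Hg. exact (is_RInt_gen_minus _ _ _ _ Hf Hg). Qed.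

Lemma is_RInt_pos_scal (k : R) (f : R -> R) (lf : R) :
  is_RInt_pos f lf -> is_RInt_pos (fun t => k * f t) (k * lf).
Proof. intros Hf. exact (is_RInt_gen_scal _ k _ Hf). Qed.

Lemma is_RInt_pos_le (f g : R -> R) (lf lg : R) :
  (forall t, 0 < t -> f t <= g t) ->
  is_RInt_pos f lf -> is_RInt_pos g lg -> lf <= lg.
Proof.
  intros H Hf Hg. apply le_epsilon. intros eps Heps.
  destruct (proj1 (is_RInt_pos_spec _ _) Hf (eps / 2) ltac:(lra)) as (e1 & M1 & He1 & H1).
  destruct (proj1 (is_RInt_pos_spec _ _) Hg (eps / 2) ltac:(lra)) as (e2 & M2 & He2 & H2).
  assert (0 < Rmin e1 e2) by (apply Rmin_glb_lt; lra).
  assert (Rmin e1 e2 <= e1) by apply Rmin_l.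
  assert (Rmin e1 e2 <= e2) by apply Rmin_r.
  assert (M1 <= Rmax M1 M2) by apply Rmax_l.
  assert (M2 <= Rmax M1 M2) by apply Rmax_r.
  set (a := Rmin e1 e2 / 2) in *. set (b := Rmax M1 M2 + 1) in *.
  destruct (H1 a b) as (y1 & I1 & J1); [unfold a; lra | unfold b; lra |].
  destruct (H2 a b) as (y2 & I2 & J2); [unfold a; lra | unfold b; lra |].
  assert (y1 <= y2).
  { apply (is_RInt_le f g a b); auto. unfold a, b; lra.
    intros x [Hx _]; apply H. unfold a in Hx; lra. }
  apply Rabs_def2 in J1. apply Rabs_def2 in J2. lra.
Qed.

Lemma is_RInt_pos_unique (f : R -> R) (l l' : R) :
  is_RInt_pos f l -> is_RInt_pos f l' -> l = l'.
Proof.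
  intros H H'. apply Rle_antisym; eapply is_RInt_pos_le; eauto; intros; lra.
Qed.

(** For a nonnegative integrand the integral over [a, b] grows with the interval, so the supremum
    over all intervals is the improper integral. *)
Lemma ex_RInt_pos_bounded (f : R -> R) (K : R) :
  (forall t, 0 < t -> continuous f t) -> (forall t, 0 < t -> 0 <= f t) ->
  (forall a b, 0 < a < b -> RInt f a b <= K) -> exists l, is_RInt_pos f l.
Proof.
  intros Hc Hp HK.
  assert (Hex : forall a b, 0 < a -> a <= b -> ex_RInt f a b).
  { intros a b Ha Hb. apply (ex_RInt_continuous (V := R_CompleteNormedModule)).
    intros z [Hz _]. apply Hc. rewrite Rmin_left in Hz; lra. }
  assert (Hmon : forall a b a' b', 0 < a' -> a' <= a -> a <= b -> b <= b' ->
     RInt f a b <= RInt f a' b').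
  { intros a b a' b' H1 H2 H3 H4.
    assert (E1 := RInt_Chasles f a' a b' (Hex _ _ H1 H2) (Hex a b' ltac:(lra) ltac:(lra))).
    assert (E2 := RInt_Chasles f a b b' (Hex a b ltac:(lra) H3) (Hex b b' ltac:(lra) ltac:(lra))).
    unfold plus in E1, E2; simpl in E1, E2.
    assert (0 <= RInt f a' a)
      by (apply RInt_ge_0; auto; intros; apply Hp; lra).
    assert (0 <= RInt f b b')
      by (apply RInt_ge_0; auto; [apply Hex; lra | intros; apply Hp; lra]).
    lra. }
  destruct (completeness (fun v => exists a b, 0 < a < b /\ v = RInt f a b)) as [l [Hl1 Hl2]].
  - exists K. intros v (a & b & H & ->). now apply HK.
  - exists (RInt f 1 2), 1, 2. split; auto; lra.
  - exists l. apply is_RInt_pos_spec. intros eps Heps.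
    assert (exists a b, 0 < a < b /\ l - eps < RInt f a b) as (a0 & b0 & H0 & H1).
    { destruct (Classical_Prop.classic (exists a b, 0 < a < b /\ l - eps < RInt f a b)) as [?|N]; auto.
      exfalso. assert (l <= l - eps); [|lra].
      apply Hl2. intros v (a & b & H & ->). apply Rnot_lt_le. intros H'. apply N; eauto. }
    exists a0, b0; split; auto. intros a b Ha Hb.
    exists (RInt f a b); split.
    + apply (RInt_correct (V := R_CompleteNormedModule)), Hex; lra.
    + assert (RInt f a b <= l) by (apply Hl1; exists a, b; split; auto; lra).
      assert (RInt f a0 b0 <= RInt f a b) by (apply Hmon; lra).
      apply Rabs_def1; lra.
Qed.

(** [f] is the difference of the nonnegative functions [f + g] and [g], and [f + g <= 2 g]. *)
Lemma ex_RInt_pos_dominated (f g : R -> R) (K : R) :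
  (forall t, 0 < t -> continuous f t) -> (forall t, 0 < t -> continuous g t) ->
  (forall t, 0 < t -> Rabs (f t) <= g t) ->
  (forall a b, 0 < a < b -> RInt g a b <= K) -> exists l, is_RInt_pos f l.
Proof.
  intros Hf Hg Hd HK.
  assert (Hex : forall (h : R -> R) a b, (forall t, 0 < t -> continuous h t) -> 0 < a < b -> ex_RInt h a b).
  { intros h a b Hh Hb. apply (ex_RInt_continuous (V := R_CompleteNormedModule)).
    intros z [Hz _]. apply Hh. rewrite Rmin_left in Hz; lra. }
  assert (Hs : forall t, 0 < t -> continuous (fun t => f t + g t) t)
    by (intros t Ht; apply (continuous_plus (V := R_NormedModule)); auto).
  destruct (ex_RInt_pos_bounded g K) as [lg Hlg]; auto.
  { intros t Ht. eapply Rle_trans; [apply Rabs_pos|apply Hd; auto]. }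
  destruct (ex_RInt_pos_bounded (fun t => f t + g t) (2 * K)) as [ls Hls]; auto.
  { intros t Ht. specialize (Hd t Ht). apply Rabs_le_between in Hd. lra. }
  { intros a b H. apply Rle_trans with (RInt (fun t => 2 * g t) a b).
    - apply RInt_le; [lra | apply Hex; auto | apply Hex; auto |].
      { intros t Ht; apply (continuous_scal_r (V := R_NormedModule)); auto. }
      intros t Ht. specialize (Hd t ltac:(lra)). apply Rabs_le_between in Hd. lra.
    - rewrite (RInt_scal (V := R_CompleteNormedModule)) by (apply Hex; auto).
      unfold scal; simpl; unfold mult; simpl. specialize (HK a b H). lra. }
  exists (ls - lg).
  apply is_RInt_pos_ext with (fun t => f t + g t - g t). intros; lra.
  now apply is_RInt_pos_minus.
Qed.

(** This is 1/(t (t^a + t^(-a))), the derivative of atan(t^a)/a. It behaves like t^(a-1) at 0 and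
    t^(-a-1) at infinity, so one elementary function dominates at both ends. *)
Definition kernel (a t : R) : R := / (t * (exp (a * ln t) + exp (- (a * ln t)))).

Lemma continuous_kernel (a t : R) : 0 < t -> continuous (kernel a) t.
Proof.
  intros Ht. apply (ex_derive_continuous (kernel a)). unfold kernel.
  assert (0 < exp (a * ln t)) by apply exp_pos.
  assert (0 < exp (- (a * ln t))) by apply exp_pos.
  auto_derive. repeat split; auto; try lra. apply Rgt_not_eq; nra.
Qed.

Lemma kernel_RInt_le (a : R) : 0 < a ->
  forall x y, 0 < x < y -> RInt (kernel a) x y <= PI / a.
Proof.
  intros Ha x y Hxy.
  assert (HI : is_RInt (kernel a) x y
     (minus (atan (exp (a * ln y)) / a) (atan (exp (a * ln x)) / a))).
  { apply (is_RInt_derive (V := R_CompleteNormedModule) (fun t => atan (exp (a * ln t)) / a)).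
    - intros t [Ht _]. rewrite Rmin_left in Ht by lra.
      unfold kernel. auto_derive. lra.
      rewrite exp_Ropp. set (E := exp (a * ln t)). assert (0 < E) by apply exp_pos.
      field. nra.
    - intros t [Ht _]. rewrite Rmin_left in Ht by lra.
      apply continuous_kernel; lra. }
  rewrite (is_RInt_unique _ _ _ _ HI).
  unfold minus, plus, opp; simpl.
  assert (H1 := atan_bound (exp (a * ln y))). assert (H2 := atan_bound (exp (a * ln x))).
  apply Rmult_le_reg_r with a; auto.
  field_simplify; lra.
Qed.

Lemma ex_RInt_pos_kernel (f : R -> R) (a C : R) : 0 < a -> 0 <= C ->
  (forall t, 0 < t -> continuous f t) ->
  (forall t, 0 < t -> Rabs (f t) <= C * kernel a t) -> exists l, is_RInt_pos f l.
Proof.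
  intros Ha HC Hf Hd.
  assert (Hk : forall t, 0 < t -> continuous (fun t => C * kernel a t) t).
  { intros t Ht. apply (continuous_scal_r (V := R_NormedModule) C).
    now apply continuous_kernel. }
  apply (ex_RInt_pos_dominated f (fun t => C * kernel a t) (C * (PI / a))); auto.
  intros x y H. rewrite (RInt_scal (V := R_CompleteNormedModule)).
  - unfold scal; simpl; unfold mult; simpl.
    apply Rmult_le_compat_l; auto. now apply kernel_RInt_le.
  - apply (ex_RInt_continuous (V := R_CompleteNormedModule)).
    intros z [Hz _]. apply continuous_kernel. rewrite Rmin_left in Hz; lra.
Qed.

(** * Euler's integral at real arguments *)

Lemma exp_ge_sqr (x : R) : 0 <= x -> x ^ 2 / 4 <= exp x.
Proof.
  intros Hx. replace (exp x) with (exp (x / 2) * exp (x / 2))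
    by (rewrite <- exp_plus; f_equal; lra).
  assert (1 + x / 2 <= exp (x / 2)) by apply exp_ineq1_le. nra.
Qed.

Lemma exp_le (x y : R) : x <= y -> exp x <= exp y.
Proof. intros [H| ->]; [left; now apply exp_increasing | right; reflexivity]. Qed.

(** The [j]th derivative of t^(y-1) e^(-t) in [y]: [j] = 0 and 1 give Gamma and its derivative, [j]
    = 2 bounds the Taylor remainder. *)
Definition gamma_integrand (j : nat) (y t : R) : R :=
  exp ((y - 1) * ln t - t) * ln t ^ j.

(** With u = ln t, the weight t^y e^(-t) decays at least like e^(-y|u|) in both directions; half of
    that decay absorbs |u|^j. *)
Lemma Gamma_weight_bound (j : nat) (y : R) : (j <= 2)%nat -> 0 < y ->
  exists C, 0 <= C /\ forall t, 0 < t ->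
    Rabs (exp (y * ln t - t) * ln t ^ j) <= C * exp (- (y / 2 * Rabs (ln t))).
Proof.
  (* 16/y^2 comes from x^2/4 <= e^x at x = y|u|/2, the 1 covers lower powers of |u|, and 4 y^2 comes
     from completing the square in 2yu - u^2/4 <= 4 y^2. *)
  intros Hj Hy. exists ((1 + 16 / y ^ 2) * exp (4 * y ^ 2)).
  assert (Hq : 0 < 16 / y ^ 2) by (apply Rdiv_lt_0_compat; nra).
  assert (He := exp_pos (4 * y ^ 2)).
  split. nra.
  intros t Ht. set (u := ln t).
  assert (Hu : t = exp u) by (unfold u; now rewrite exp_ln).
  rewrite Rabs_mult, (Rabs_pos_eq (exp _)) by (left; apply exp_pos).
  set (v := Rabs u). assert (Hv : 0 <= v) by apply Rabs_pos.
  assert (A1 : Rabs (u ^ j) <= (1 + 16 / y ^ 2) * exp (y / 2 * v)).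
  { assert (1 <= exp (y / 2 * v)).
    { rewrite <- exp_0. apply exp_le. nra. }
    assert (B : (y / 2 * v) ^ 2 / 4 <= exp (y / 2 * v)) by (apply exp_ge_sqr; nra).
    assert (v ^ 2 <= 16 / y ^ 2 * exp (y / 2 * v)).
    { replace (v ^ 2) with (16 / y ^ 2 * ((y / 2 * v) ^ 2 / 4)) by (field; lra).
      apply Rmult_le_compat_l; lra. }
    rewrite <- RPow_abs. fold v.
    destruct j as [|[|[|]]]; [| | |lia]; simpl in *; nra. }
  assert (A2 : exp (y * u - t) <= exp (4 * y ^ 2) * exp (- (y * v))).
  { rewrite <- exp_plus. apply exp_le. unfold v.
    destruct (Rle_dec 0 u) as [H|H].
    - rewrite Rabs_pos_eq by auto. assert (u ^ 2 / 4 <= exp u) by now apply exp_ge_sqr.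
      rewrite Hu. assert (0 <= (u / 2 - 2 * y) ^ 2) by apply pow2_ge_0. nra.
    - rewrite Rabs_left by lra. nra. }
  replace (- (y / 2 * v)) with (- (y * v) + y / 2 * v) by field.
  rewrite exp_plus.
  replace ((1 + 16 / y ^ 2) * exp (4 * y ^ 2) * (exp (- (y * v)) * exp (y / 2 * v)))
    with ((exp (4 * y ^ 2) * exp (- (y * v))) * ((1 + 16 / y ^ 2) * exp (y / 2 * v))) by ring.
  apply Rmult_le_compat; auto. left; apply exp_pos. apply Rabs_pos.
Qed.

Lemma gamma_integrand_weight (j : nat) (y t : R) : 0 < t ->
  gamma_integrand j y t = exp (y * ln t - t) * ln t ^ j / t.
Proof.
  intros Ht. unfold gamma_integrand.
  replace ((y - 1) * ln t - t) with (y * ln t - t + - ln t) by ring.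
  rewrite exp_plus, (exp_Ropp (ln t)), exp_ln by auto. field. lra.
Qed.

Lemma continuous_gamma_integrand (j : nat) (y t : R) :
  0 < t -> continuous (gamma_integrand j y) t.
Proof.
  intros Ht. apply (ex_derive_continuous (gamma_integrand j y)).
  unfold gamma_integrand. auto_derive. auto.
Qed.

Lemma ex_RInt_pos_gamma_integrand (j : nat) (y : R) : (j <= 2)%nat -> 0 < y ->
  exists l, is_RInt_pos (gamma_integrand j y) l.
Proof.
  intros Hj Hy. destruct (Gamma_weight_bound j y Hj Hy) as (C & HC & HB).
  (* The factor 2: both e^(au) and e^(-au) are at most e^(a|u|), so e^(-a|u|) <= 2/(e^(au) +
     e^(-au)). *)
  apply (ex_RInt_pos_kernel _ (y / 2) (2 * C)); try lra.
  { intros; now apply continuous_gamma_integrand. }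
  intros t Ht. rewrite gamma_integrand_weight by auto.
  unfold Rdiv at 1. rewrite Rabs_mult, (Rabs_pos_eq (/ t)) by (left; now apply Rinv_0_lt_compat).
  apply Rle_trans with (C * exp (- (y / 2 * Rabs (ln t))) * / t).
  { apply Rmult_le_compat_r; auto. left; now apply Rinv_0_lt_compat. }
  unfold kernel.
  set (a := y / 2). set (u := ln t).
  assert (P1 := exp_pos (a * u)). assert (P2 := exp_pos (- (a * u))).
  assert (P3 := exp_pos (a * Rabs u)).
  assert (exp (a * u) <= exp (a * Rabs u)).
  { apply exp_le. apply Rmult_le_compat_l. unfold a; lra. apply Rle_abs. }
  assert (exp (- (a * u)) <= exp (a * Rabs u)).
  { apply exp_le. rewrite Ropp_mult_distr_r. apply Rmult_le_compat_l. unfold a; lra.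
    rewrite <- Rabs_Ropp. apply Rle_abs. }
  rewrite exp_Ropp.
  replace (C * / exp (a * Rabs u) * / t) with (2 * C * / (t * (2 * exp (a * Rabs u))))
    by (field; lra).
  apply Rmult_le_compat_l. lra.
  apply Rinv_le_contravar. apply Rmult_lt_0_compat; lra.
  apply Rmult_le_compat_l; lra.
Qed.

Definition gamma_int (j : nat) (y : R) : R :=
  RInt_gen (V := R_CompleteNormedModule)
    (gamma_integrand j y) (at_right 0) (Rbar_locally p_infty).

Lemma gamma_int_correct (j : nat) (y : R) : (j <= 2)%nat -> 0 < y ->
  is_RInt_pos (gamma_integrand j y) (gamma_int j y).
Proof.
  intros Hj Hy.
  apply (RInt_gen_correct (V := R_CompleteNormedModule)).
  destruct (ex_RInt_pos_gamma_integrand j y Hj Hy) as [l Hl]. exists l. exact Hl.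
Qed.

(** The bound makes [F] vanish at 0 and at infinity. With F = t^y e^(-t) (ln t)^j this is the
    integration by parts behind the recurrences of Gamma and its derivative. *)
Lemma is_RInt_pos_derive_0 (F f : R -> R) (a C : R) : 0 < a -> 0 <= C ->
  (forall t, 0 < t -> is_derive F t (f t)) ->
  (forall t, 0 < t -> continuous f t) ->
  (forall t, 0 < t -> Rabs (F t) <= C * exp (- (a * Rabs (ln t)))) ->
  is_RInt_pos f 0.
Proof.
  intros Ha HC Hd Hc HF. apply is_RInt_pos_spec. intros eps Heps.
  (* Since e^v >= 1 + v, the bound on [F] drops below [eps / 2] once v = a |ln t| exceeds a K =
     2C/eps + a. *)
  set (K := 2 * C / (a * eps) + 1).
  assert (HK : 0 < K).
  { assert (0 <= 2 * C / (a * eps)) by (apply Rdiv_le_0_compat; nra). unfold K; lra. }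
  assert (Hsmall : forall t, 0 < t -> K < Rabs (ln t) -> Rabs (F t) < eps / 2).
  { intros t Ht HKt. eapply Rle_lt_trans. now apply HF.
    rewrite exp_Ropp. set (v := a * Rabs (ln t)).
    assert (Hv : a * K < v) by (now apply Rmult_lt_compat_l).
    assert (1 + v <= exp v) by apply exp_ineq1_le.
    assert (a * K = 2 * C / eps + a) by (unfold K; field; lra).
    assert (0 < a * K) by nra.
    apply Rmult_lt_reg_r with (exp v). apply exp_pos.
    rewrite Rmult_assoc, Rinv_l by (apply Rgt_not_eq, exp_pos).
    assert (2 * C / eps * (eps / 2) = C) by (field; lra). nra. }
  exists (exp (- K)), (exp K). split.
  { split. apply exp_pos. apply exp_increasing; lra. }
  intros x y Hx Hy. exists (F y - F x).
  assert (exp (- K) < exp K) by (apply exp_increasing; lra).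
  split.
  - apply (is_RInt_derive (V := R_CompleteNormedModule) F f);
      intros t [Ht _]; rewrite Rmin_left in Ht by lra; [apply Hd | apply Hc]; lra.
  - assert (Rabs (F x) < eps / 2).
    { apply Hsmall. tauto. assert (ln x < - K).
      { rewrite <- (ln_exp (- K)). apply ln_increasing; tauto. }
      rewrite Rabs_left; lra. }
    assert (Rabs (F y) < eps / 2).
    { apply Hsmall. assert (0 < exp K) by apply exp_pos; lra. assert (K < ln y).
      { rewrite <- (ln_exp K). apply ln_increasing; auto. apply exp_pos. }
      rewrite Rabs_pos_eq; lra. }
    rewrite Rminus_0_r. unfold Rminus. eapply Rle_lt_trans. apply Rabs_triang.
    rewrite Rabs_Ropp. lra.
Qed.

Lemma gamma_int_0_succ (y : R) : 0 < y -> gamma_int 0 (y + 1) = y * gamma_int 0 y.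
Proof.
  intros Hy.
  destruct (Gamma_weight_bound 0 y ltac:(lia) Hy) as (C & HC & HB).
  assert (H0 := gamma_int_correct 0 y ltac:(lia) Hy).
  assert (H1 := gamma_int_correct 0 (y + 1) ltac:(lia) ltac:(lra)).
  assert (E := is_RInt_pos_minus _ _ _ _ (is_RInt_pos_scal y _ _ H0) H1).
  assert (Z : y * gamma_int 0 y - gamma_int 0 (y + 1) = 0); [|lra].
  apply (is_RInt_pos_unique _ _ _ E).
  apply (is_RInt_pos_derive_0 (fun t => exp (y * ln t - t) * ln t ^ 0) _ (y / 2) C); auto.
  lra.
  - intros t Ht. rewrite !gamma_integrand_weight by auto.
    replace ((y + 1) * ln t - t) with (y * ln t - t + ln t) by ring.
    rewrite (exp_plus (y * ln t - t)), exp_ln by auto.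
    auto_derive. auto. simpl. unfold Rminus. field. lra.
  - intros t Ht. apply (continuous_minus (V := R_NormedModule)).
    apply (continuous_scal_r (V := R_NormedModule)). 
    all: now apply continuous_gamma_integrand.
Qed.

Lemma gamma_int_1_succ (y : R) : 0 < y ->
  gamma_int 1 (y + 1) = gamma_int 0 y + y * gamma_int 1 y.
Proof.
  intros Hy.
  destruct (Gamma_weight_bound 1 y ltac:(lia) Hy) as (C & HC & HB).
  assert (H0 := gamma_int_correct 0 y ltac:(lia) Hy).
  assert (H1 := gamma_int_correct 1 y ltac:(lia) Hy).
  assert (H2 := gamma_int_correct 1 (y + 1) ltac:(lia) ltac:(lra)).
  assert (E := is_RInt_pos_minus _ _ _ _
    (is_RInt_pos_plus _ _ _ _ H0 (is_RInt_pos_scal y _ _ H1)) H2).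
  assert (Z : gamma_int 0 y + y * gamma_int 1 y - gamma_int 1 (y + 1) = 0); [|lra].
  apply (is_RInt_pos_unique _ _ _ E).
  apply (is_RInt_pos_derive_0 (fun t => exp (y * ln t - t) * ln t ^ 1) _ (y / 2) C); auto.
  lra.
  - intros t Ht. rewrite !gamma_integrand_weight by auto.
    replace ((y + 1) * ln t - t) with (y * ln t - t + ln t) by ring.
    rewrite (exp_plus (y * ln t - t)), exp_ln by auto.
    auto_derive. auto. simpl. unfold Rminus. field. lra.
  - intros t Ht. apply (continuous_minus (V := R_NormedModule)).
    apply (continuous_plus (V := R_NormedModule)).
    2: apply (continuous_scal_r (V := R_NormedModule)). 
    all: now apply continuous_gamma_integrand.
Qed.

Lemma exp_taylor_1 (x : R) : 0 <= exp x - 1 - x <= x ^ 2 * exp (Rabs x).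
Proof.
  assert (H1 := exp_ineq1_le x). assert (H2 := exp_ineq1_le (- x)).
  split. lra.
  assert (P1 := exp_pos x). assert (P2 := exp_pos (- x)).
  assert (E : exp x * exp (- x) = 1) by (rewrite <- exp_plus, Rplus_opp_r; apply exp_0).
  assert (exp x - 1 <= x * exp x) by nra.
  destruct (Rle_dec 0 x).
  - rewrite Rabs_pos_eq by auto. nra.
  - rewrite Rabs_left by lra. assert (1 <= exp (- x)) by lra. nra.
Qed.

(** Differentiation under the integral with an explicit remainder: for |h| <= y/2 the factor e^|h ln
    t| is at most t^(y/2) + t^(-y/2), so integrands of order 2 at 3y/2 and y/2 dominate uniformly in
    [h]. *)
Lemma gamma_int_taylor (y h : R) : 0 < y -> Rabs h <= y / 2 ->
  Rabs (gamma_int 0 (y + h) - gamma_int 0 y - h * gamma_int 1 y)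
    <= h ^ 2 * (gamma_int 2 (y + y / 2) + gamma_int 2 (y - y / 2)).
Proof.
  intros Hy Hh. assert (Hh' := Hh). apply Rabs_le_between in Hh'.
  assert (H0 := gamma_int_correct 0 y ltac:(lia) Hy).
  assert (H1 := gamma_int_correct 1 y ltac:(lia) Hy).
  assert (Hp := gamma_int_correct 0 (y + h) ltac:(lia) ltac:(lra)).
  assert (E := is_RInt_pos_minus _ _ _ _ (is_RInt_pos_minus _ _ _ _ Hp H0)
                 (is_RInt_pos_scal h _ _ H1)).
  assert (H2 := gamma_int_correct 2 (y + y / 2) ltac:(lia) ltac:(lra)).
  assert (H3 := gamma_int_correct 2 (y - y / 2) ltac:(lia) ltac:(lra)).
  assert (B := is_RInt_pos_scal (h ^ 2) _ _ (is_RInt_pos_plus _ _ _ _ H2 H3)).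
  assert (Hpt : forall t, 0 < t ->
    0 <= gamma_integrand 0 (y + h) t - gamma_integrand 0 y t - h * gamma_integrand 1 y t
      <= h ^ 2 * (gamma_integrand 2 (y + y / 2) t + gamma_integrand 2 (y - y / 2) t)).
  { intros t Ht. unfold gamma_integrand. set (u := ln t).
    replace ((y + h - 1) * u - t) with ((y - 1) * u - t + h * u) by ring.
    replace ((y + y / 2 - 1) * u - t) with ((y - 1) * u - t + y / 2 * u) by ring.
    replace ((y - y / 2 - 1) * u - t) with ((y - 1) * u - t + - (y / 2 * u)) by ring.
    rewrite !exp_plus. set (w := exp ((y - 1) * u - t)).
    assert (Hw : 0 < w) by apply exp_pos.
    destruct (exp_taylor_1 (h * u)) as [T1 T2].
    assert (T3 : exp (Rabs (h * u)) <= exp (y / 2 * u) + exp (- (y / 2 * u))).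
    { apply Rle_trans with (exp (Rabs (y / 2 * u))).
      { apply exp_le. rewrite !Rabs_mult. apply Rmult_le_compat_r. apply Rabs_pos.
        rewrite (Rabs_pos_eq (y / 2)); lra. }
      assert (P1 := exp_pos (y / 2 * u)). assert (P2 := exp_pos (- (y / 2 * u))).
      unfold Rabs; destruct (Rcase_abs (y / 2 * u)); lra. }
    assert (T4 : (h * u) ^ 2 * exp (Rabs (h * u)) <=
                 (h * u) ^ 2 * (exp (y / 2 * u) + exp (- (y / 2 * u))))
      by (apply Rmult_le_compat_l; [apply pow2_ge_0 | auto]).
    set (P := exp (y / 2 * u)) in *. set (Q := exp (- (y / 2 * u))) in *.
    set (Z := exp (h * u)) in *. simpl.
    replace (w * Z * 1 - w * 1 - h * (w * (u * 1))) with (w * (Z - 1 - h * u)) by ring.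
    replace (h * (h * 1) * (w * P * (u * (u * 1)) + w * Q * (u * (u * 1))))
      with (w * ((h * u) ^ 2 * (P + Q))) by ring.
    split.
    - apply Rmult_le_pos; lra.
    - apply Rmult_le_compat_l; lra. }
  assert (L1 := is_RInt_pos_le _ _ _ _ (fun t Ht => proj2 (Hpt t Ht)) E B).
  rewrite Rabs_pos_eq; auto.
  (* For nonnegativity, 0 is written as the integral of 0 times an integrand known to converge. *)
  rewrite <- (Rmult_0_l (gamma_int 0 y)).
  apply (is_RInt_pos_le _ _ _ _ (fun t Ht => Rle_trans _ _ _ (Req_le _ _ (Rmult_0_l _)) (proj1 (Hpt t Ht)))
           (is_RInt_pos_scal 0 _ _ H0) E).
Qed.

Lemma is_derive_gamma_int (y : R) : 0 < y -> is_derive (gamma_int 0) y (gamma_int 1 y).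
Proof.
  intros Hy. apply is_derive_Reals. intros eps Heps.
  set (M := gamma_int 2 (y + y / 2) + gamma_int 2 (y - y / 2)).
  (* The Taylor bound itself, at h = y/2, shows that [M] is nonnegative. *)
  assert (HM : 0 <= M).
  { assert (Hh : Rabs (y / 2) <= y / 2) by (rewrite Rabs_pos_eq; lra).
    assert (B := gamma_int_taylor y (y / 2) Hy Hh). fold M in B.
    assert (0 <= (y / 2) ^ 2 * M) by (eapply Rle_trans; [apply Rabs_pos | exact B]).
    assert (0 < (y / 2) ^ 2) by (apply pow_lt; lra).
    apply Rmult_le_reg_l with ((y / 2) ^ 2); lra. }
  assert (Hd : 0 < Rmin (y / 2) (eps / (M + 1))).
  { apply Rmin_glb_lt. lra. apply Rdiv_lt_0_compat; lra. }
  exists (mkposreal _ Hd). simpl. intros h Hh0 Hh.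
  assert (Hh1 := Rlt_le_trans _ _ _ Hh (Rmin_l _ _)).
  assert (Hh2 := Rlt_le_trans _ _ _ Hh (Rmin_r _ _)).
  assert (B := gamma_int_taylor y h Hy ltac:(lra)). fold M in B.
  assert (Hp : 0 < Rabs h) by now apply Rabs_pos_lt.
  replace ((gamma_int 0 (y + h) - gamma_int 0 y) / h - gamma_int 1 y)
    with ((gamma_int 0 (y + h) - gamma_int 0 y - h * gamma_int 1 y) / h) by (field; auto).
  unfold Rdiv. rewrite Rabs_mult, Rabs_inv.
  apply Rmult_lt_reg_r with (Rabs h); auto.
  rewrite Rmult_assoc, Rinv_l, Rmult_1_r by lra.
  rewrite <- pow2_abs in B.
  assert (Rabs h * (M + 1) < eps).
  { apply Rmult_lt_reg_r with (/ (M + 1)). apply Rinv_0_lt_compat; lra.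
    rewrite Rmult_assoc, Rinv_r, Rmult_1_r by lra. exact Hh2. }
  nra.
Qed.

Lemma gamma_int_0_pos (y : R) : 0 < y -> 0 < gamma_int 0 y.
Proof.
  intros Hy.
  assert (H0 := gamma_int_correct 0 y ltac:(lia) Hy).
  set (f := gamma_integrand 0 y) in *.
  assert (Hp : forall t, 0 < f t).
  { intros t. unfold f, gamma_integrand. simpl. rewrite Rmult_1_r. apply exp_pos. }
  assert (Hex : forall a b, 0 < a -> a <= b -> ex_RInt f a b).
  { intros a b Ha Hb. apply (ex_RInt_continuous (V := R_CompleteNormedModule)).
    intros z [Hz _]. apply continuous_gamma_integrand. rewrite Rmin_left in Hz; lra. }
  assert (HI : 0 < RInt f 1 2).
  { apply RInt_gt_0; auto. lra. intros x Hx.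
    apply continuous_gamma_integrand; lra. }
  apply Rlt_le_trans with (1 := HI). apply le_epsilon. intros eps Heps.
  destruct (proj1 (is_RInt_pos_spec _ _) H0 eps Heps) as (e & M & He & HH).
  assert (0 < Rmin e 1) by (apply Rmin_glb_lt; lra).
  assert (Rmin e 1 <= e) by apply Rmin_l. assert (Rmin e 1 <= 1) by apply Rmin_r.
  assert (M <= Rmax M 2) by apply Rmax_l. assert (2 <= Rmax M 2) by apply Rmax_r.
  set (a := Rmin e 1 / 2) in *. set (b := Rmax M 2 + 1) in *.
  assert (Ha : 0 < a < e /\ a <= 1) by (unfold a; lra).
  assert (Hb : M < b /\ 2 <= b) by (unfold b; lra).
  destruct (HH a b (proj1 Ha) (proj1 Hb)) as (v & Hv & Hv').
  apply Rabs_def2 in Hv'.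
  rewrite <- (is_RInt_unique (V := R_CompleteNormedModule) _ _ _ _ Hv) in Hv'.
  assert (E1 := RInt_Chasles f a 1 b (Hex a 1 ltac:(lra) ltac:(lra)) (Hex 1 b ltac:(lra) ltac:(lra))).
  assert (E2 := RInt_Chasles f 1 2 b (Hex 1 2 ltac:(lra) ltac:(lra)) (Hex 2 b ltac:(lra) ltac:(lra))).
  unfold plus in E1, E2; simpl in E1, E2.
  assert (0 <= RInt f a 1)
    by (apply RInt_ge_0; [lra | apply Hex; lra | intros; left; apply Hp]).
  assert (0 <= RInt f 2 b)
    by (apply RInt_ge_0; [lra | apply Hex; lra | intros; left; apply Hp]).
  lra.
Qed.

(** * Bounds and recurrence for the logarithmic derivative of Gamma *)

Definition log_der (y : R) : R := gamma_int 1 y / gamma_int 0 y.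

(* Integrate t^(y+h-1) e^(-t) >= t^(y-1) e^(-t) e^(hc) (1 + h (ln t - c)) with
   c = log_der y: the linear term integrates to 0. *)
Lemma gamma_int_tangent (y h : R) : 0 < y -> 0 < y + h ->
  exp (h * log_der y) * gamma_int 0 y <= gamma_int 0 (y + h).
Proof.
  intros Hy Hh. assert (HG := gamma_int_0_pos y Hy).
  assert (H0 := gamma_int_correct 0 y ltac:(lia) Hy).
  assert (H1 := gamma_int_correct 1 y ltac:(lia) Hy).
  assert (Hp := gamma_int_correct 0 (y + h) ltac:(lia) Hh).
  set (c := log_der y). set (k := exp (h * c)).
  assert (A := is_RInt_pos_plus _ _ _ _ (is_RInt_pos_scal (k * (1 - h * c)) _ _ H0)
                 (is_RInt_pos_scal (k * h) _ _ H1)).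
  replace (k * gamma_int 0 y)
    with (k * (1 - h * c) * gamma_int 0 y + k * h * gamma_int 1 y).
  2:{ unfold c, log_der. field. lra. }
  apply (is_RInt_pos_le _ _ _ _) with (2 := A) (3 := Hp).
  intros t Ht. unfold gamma_integrand. set (u := ln t).
  replace ((y + h - 1) * u - t) with ((y - 1) * u - t + (h * c + h * (u - c))) by ring.
  rewrite !exp_plus. fold k. set (w := exp ((y - 1) * u - t)).
  assert (Hw : 0 < w) by apply exp_pos. assert (Hk : 0 < k) by apply exp_pos.
  assert (T := exp_ineq1_le (h * (u - c))). simpl.
  replace (k * (1 - h * c) * (w * 1) + k * h * (w * (u * 1)))
    with ((w * k) * (1 + h * (u - c))) by ring.
  replace (w * (k * exp (h * (u - c))) * 1) with ((w * k) * exp (h * (u - c))) by ring.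
  apply Rmult_le_compat_l; auto. nra.
Qed.

(** The tangent bound with h = 1: since Gamma(y + 1) = y Gamma(y), it reads e^(psi(y)) <= y. Taking
    h = -1 at y + 1 gives the companion lower bound. *)
Lemma log_der_le (y : R) : 0 < y -> log_der y <= ln y.
Proof.
  intros Hy. assert (HG := gamma_int_0_pos y Hy).
  assert (T := gamma_int_tangent y 1 Hy ltac:(lra)).
  rewrite gamma_int_0_succ, Rmult_1_l in T by auto.
  rewrite <- (ln_exp (log_der y)). apply Rcomplements.ln_le. apply exp_pos. nra.
Qed.

Lemma log_der_succ_ge (y : R) : 0 < y -> ln y <= log_der (y + 1).
Proof.
  intros Hy. assert (HG := gamma_int_0_pos y Hy).
  assert (T := gamma_int_tangent (y + 1) (- 1) ltac:(lra) ltac:(lra)).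
  replace (y + 1 + -1) with y in T by ring.
  rewrite gamma_int_0_succ in T by auto.
  rewrite <- (ln_exp (log_der (y + 1))). apply Rcomplements.ln_le; auto.
  replace (-1 * log_der (y + 1)) with (- log_der (y + 1)) in T by ring.
  rewrite exp_Ropp in T. set (E := exp (log_der (y + 1))) in *.
  assert (0 < E) by apply exp_pos.
  apply Rmult_le_reg_r with (gamma_int 0 y); auto.
  apply Rmult_le_reg_l with (/ E). now apply Rinv_0_lt_compat.
  rewrite <- (Rmult_assoc (/ E) E), Rinv_l, Rmult_1_l by lra. exact T.
Qed.

Lemma log_der_succ (y : R) : 0 < y -> log_der (y + 1) = log_der y + / y.
Proof.
  intros Hy. assert (HG := gamma_int_0_pos y Hy).
  unfold log_der. rewrite gamma_int_0_succ, gamma_int_1_succ by auto.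
  field. lra.
Qed.

(** * Partial sums of the Digamma series *)

Lemma ln_sub_le (a b : R) : 0 < a -> 0 < b -> ln a - ln b <= (a - b) / b.
Proof.
  intros Ha Hb. rewrite <- Rcomplements.ln_div by auto.
  assert (Hq : 0 < a / b) by (apply Rdiv_lt_0_compat; auto).
  assert (H := exp_ineq1_le (ln (a / b))). rewrite exp_ln in H by auto.
  replace ((a - b) / b) with (a / b - 1) by (field; lra). lra.
Qed.

Lemma is_lim_seq_inv_shift (c d : R) : is_lim_seq (fun N => c / (d + INR N)) 0.
Proof.
  replace (Finite 0) with (Rbar_mult c 0) by (simpl; f_equal; ring).
  apply is_lim_seq_scal_l.
  apply (is_lim_seq_inv _ p_infty); [|easy].
  eapply is_lim_seq_plus; [apply is_lim_seq_const | apply is_lim_seq_INR | easy].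
Qed.

Lemma sum_n_S (f : nat -> R) (n : nat) : sum_n f (S n) = sum_n f n + f (S n).
Proof. exact (sum_Sn f n). Qed.

(** * Euler's constant: convergence and the bounds 0 < gamma < 1 *)

Definition harmonic (n : nat) : R := sum_n (fun k => / INR (S k)) n.

Lemma harmonic_succ (n : nat) : harmonic (S n) = harmonic n + / (INR n + 2).
Proof.
  unfold harmonic. rewrite sum_n_S, !S_INR. do 2 f_equal. ring.
Qed.

Lemma EulerGamma_seq_decr (n : nat) :
  harmonic (S n) - ln (INR (S (S n))) <= harmonic n - ln (INR (S n)).
Proof.
  rewrite harmonic_succ, !S_INR. assert (P := pos_INR n).
  assert (H := ln_sub_le (INR n + 1) (INR n + 1 + 1) ltac:(lra) ltac:(lra)).
  replace ((INR n + 1 - (INR n + 1 + 1)) / (INR n + 1 + 1)) with (- / (INR n + 2)) in H by (field; lra).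
  lra.
Qed.

(** [harmonic n] is H_(n+1). With ln (n + 2) in place of ln (n + 1) the sequence increases, starting
    from 1 - ln 2. *)
Lemma EulerGamma_seq_ge (n : nat) : 1 - ln 2 <= harmonic n - ln (INR n + 2).
Proof.
  induction n as [|n IH].
  - unfold harmonic. rewrite sum_O. simpl. rewrite Rplus_0_l, Rinv_1. lra.
  - rewrite harmonic_succ, S_INR. assert (P := pos_INR n).
    assert (H := ln_sub_le (INR n + 1 + 2) (INR n + 2) ltac:(lra) ltac:(lra)).
    replace ((INR n + 1 + 2 - (INR n + 2)) / (INR n + 2)) with (/ (INR n + 2)) in H by (field; lra).
    lra.
Qed.

Lemma is_lim_EulerGamma :
  is_lim_seq (fun n => harmonic n - ln (INR (S n))) EulerGamma.
Proof.
  apply Lim_seq_correct'.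
  apply (ex_finite_lim_seq_decr _ (1 - ln 2)).
  - intros n. apply EulerGamma_seq_decr.
  - intros n. assert (H := EulerGamma_seq_ge n). rewrite S_INR. assert (P := pos_INR n).
    assert (ln (INR n + 1) <= ln (INR n + 2)) by (apply Rcomplements.ln_le; lra). lra.
Qed.

(** These bounds say psi(1) = - gamma < 0 < 1 - gamma = psi(2), which locates the positive zero. *)
Lemma EulerGamma_bounds : 0 < EulerGamma < 1.
Proof.
  (* Index 0 would give only [EulerGamma <= 1]; index 1 gives 3/2 - ln 2. *)
  assert (H1 : EulerGamma <= harmonic 1 - ln (INR 2)).
  { apply (is_lim_seq_decr_compare _ _ is_lim_EulerGamma). apply EulerGamma_seq_decr. }
  assert (Hn : forall n, 1 - ln 2 <= harmonic n - ln (INR (S n))).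
  { intros n. assert (H := EulerGamma_seq_ge n). rewrite S_INR. assert (P := pos_INR n).
    assert (ln (INR n + 1) <= ln (INR n + 2)) by (apply Rcomplements.ln_le; lra). lra. }
  assert (H2 : Rbar_le (1 - ln 2) EulerGamma).
  { apply (is_lim_seq_le (fun _ => 1 - ln 2) _ _ _ Hn (is_lim_seq_const _) is_lim_EulerGamma). }
  simpl in H2. unfold harmonic in H1. rewrite sum_n_S, sum_O in H1.
  replace (INR 2) with 2 in H1 by (simpl; ring). replace (INR 1) with 1 in H1 by reflexivity.
  assert (H3 := ln_lt_2).
  assert (H4 : ln 2 < 1).
  { rewrite <- (ln_exp 1). apply ln_increasing. lra.
    assert (H := exp_ineq1 1 ltac:(lra)). lra. }
  lra.
Qed.

(** * Truncated Digamma series and their limit *)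

Definition psi_part (N : nat) (z : R) : R :=
  - EulerGamma + sum_n (fun n => / INR (S n) - / (z + INR n)) N.

Fixpoint pole_sum (x : R) (m : nat) : R :=
  match m with O => 0 | S k => pole_sum x k + / (x + INR k) end.

Lemma psi_part_pole_sum (N : nat) (x : R) :
  psi_part N x = - EulerGamma + harmonic N - pole_sum x (S N).
Proof.
  unfold psi_part, harmonic. induction N as [|N IH].
  - rewrite !sum_O. simpl. lra.
  - rewrite !sum_n_S.
    change (pole_sum x (S (S N))) with (pole_sum x (S N) + / (x + INR (S N))). lra.
Qed.

(** By psi(y + 1) = psi(y) + 1/y all sufficiently large shifts give the same number; off the poles
    it is psi(x), also to the left of 0. *)
Lemma log_der_pole_sum_const (x : R) (m k : nat) : 0 < x + INR m ->
  log_der (x + INR (m + k)) - pole_sum x (m + k) = log_der (x + INR m) - pole_sum x m.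
Proof.
  intros H. induction k as [|k IH].
  - now rewrite Nat.add_0_r.
  - rewrite Nat.add_succ_r, S_INR. simpl. rewrite <- IH.
    replace (x + (INR (m + k) + 1)) with (x + INR (m + k) + 1) by ring.
    rewrite log_der_succ. lra. rewrite plus_INR. assert (P := pos_INR k). lra.
Qed.

Lemma is_lim_psi_part (x : R) (m : nat) : 0 < x + INR m ->
  is_lim_seq (fun N => psi_part N x) (log_der (x + INR m) - pole_sum x m).
Proof.
  intros Hm.
  (* psi(x + N + 1) lies between ln (x + N) and ln (x + N + 1), which differ from ln (N + 1) by
     O(1/N). *)
  assert (L : is_lim_seq (fun N => ln (INR (S N)) - log_der (x + INR (S N))) 0).
  { apply (is_lim_seq_le_le_loc (fun N => - x / (1 + INR N)) _ (fun N => (1 - x) / (x + INR N)));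
      [| apply is_lim_seq_inv_shift | apply is_lim_seq_inv_shift].
    exists m. intros n Hn. assert (P := pos_INR n).
    assert (INR m <= INR n) by now apply le_INR.
    rewrite S_INR. replace (x + (INR n + 1)) with (x + INR n + 1) by ring.
    assert (H1 := log_der_succ_ge (x + INR n) ltac:(lra)).
    assert (H2 := log_der_le (x + INR n + 1) ltac:(lra)).
    assert (H3 := ln_sub_le (x + INR n + 1) (INR n + 1) ltac:(lra) ltac:(lra)).
    assert (H4 := ln_sub_le (INR n + 1) (x + INR n) ltac:(lra) ltac:(lra)).
    replace ((x + INR n + 1 - (INR n + 1)) / (INR n + 1)) with (- (- x / (1 + INR n))) in H3
      by (field; lra).
    replace ((INR n + 1 - (x + INR n)) / (x + INR n)) with ((1 - x) / (x + INR n)) in H4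
      by (field; lra).
    lra. }
  set (c := log_der (x + INR m) - pole_sum x m).
  assert (S1 := is_lim_seq_plus' _ _ _ _ (is_lim_seq_plus' _ _ _ _ is_lim_EulerGamma L)
                 (is_lim_seq_const (c - EulerGamma))).
  replace (EulerGamma + 0 + (c - EulerGamma)) with c in S1 by ring.
  apply is_lim_seq_ext_loc with (2 := S1).
  exists m. intros n Hn. rewrite psi_part_pole_sum.
  assert (E := log_der_pole_sum_const x m (S n - m) Hm).
  replace (m + (S n - m))%nat with (S n) in E by lia. fold c in E. lra.
Qed.

(** * The Digamma function on the real line *)

Lemma is_RInt_gen_RtoC (f : R -> R) (l : R) : is_RInt_pos f l ->
  is_RInt_gen (V := C_R_CompleteNormedModule) (fun t => RtoC (f t))
    (at_right 0) (Rbar_locally p_infty) (RtoC l).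
Proof.
  intros H P [eps HP]. apply filter_prod_pos.
  destruct (proj1 (is_RInt_pos_spec _ _) H eps (cond_pos eps)) as (e & M & He & HH).
  exists e, M; split; [exact He|]. intros a b Ha Hb.
  destruct (HH a b Ha Hb) as (y & Hy1 & Hy2). exists (RtoC y). split.
  - apply (is_RInt_fct_extend_pair (U := R_NormedModule) (V := R_NormedModule)
             (fun t => RtoC (f t)) a b y 0); simpl; auto.
    assert (Z := is_RInt_const (V := R_NormedModule) a b 0).
    change (scal (b - a) 0) with ((b - a) * 0) in Z. now rewrite Rmult_0_r in Z.
  - apply HP. split; simpl. exact Hy2. apply ball_center.
Qed.

Lemma EulerIntegral_RtoC (y : R) : 0 < y -> EulerIntegral (RtoC y) = RtoC (gamma_int 0 y).
Proof.
  intros Hy. unfold EulerIntegral.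
  apply (is_RInt_gen_unique (V := C_R_CompleteNormedModule)).
  assert (H := is_RInt_gen_RtoC _ _ (gamma_int_correct 0 y ltac:(lia) Hy)).
  assert (E : forall t, RtoC (gamma_integrand 0 y t) =
     (Rcpow t (RtoC y - 1) * RtoC (exp (- t)))%C).
  { intros t. unfold gamma_integrand, Rcpow, Cexp, RtoC, Cmult, Cminus, Cplus, Copp; simpl.
    replace ((y + - (1)) * 0 + (0 + - 0) * ln t) with 0 by ring.
    rewrite sin_0, cos_0.
    replace ((y - 1) * ln t - t) with (((y + - (1)) * ln t - (0 + - 0) * 0) + - t) by ring.
    rewrite exp_plus. f_equal; ring. }
  apply (is_RInt_gen_ext (V := C_R_CompleteNormedModule) (fun t => RtoC (gamma_integrand 0 y t))); auto.
  apply filter_prod_pos. exists 1, 2; split; [lra|]. intros. apply E.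
Qed.

Fixpoint rrising (x : R) (m : nat) : R :=
  match m with O => 1 | S k => rrising x k * (x + INR k) end.

Lemma rising_RtoC (x : R) (m : nat) : rising (RtoC x) m = RtoC (rrising x m).
Proof.
  induction m as [|m IH]; simpl; auto.
  now rewrite IH, RtoC_mult, RtoC_plus.
Qed.

Definition real_domain (x : R) : Prop := forall n : nat, x <> - INR n.

Lemma Digamma_domain_RtoC (x : R) : Digamma_domain (RtoC x) <-> real_domain x.
Proof.
  split; intros H n E; apply (H n).
  - now rewrite E.
  - now apply RtoC_inj.
Qed.

Lemma rrising_neq_0 (x : R) (m : nat) : real_domain x -> rrising x m <> 0.
Proof.
  intros H. induction m as [|m IH]; simpl. lra.
  apply Rmult_integral_contrapositive. split; auto. specialize (H m). lra.
Qed.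

Lemma is_derive_shift (c x : R) : is_derive (fun y => y + c) x 1.
Proof. auto_derive; auto. Qed.

Lemma is_derive_Rmult (f g : R -> R) (x df dg : R) : is_derive f x df -> is_derive g x dg ->
  is_derive (fun y => f y * g y) x (df * g x + f x * dg).
Proof. intros Hf Hg. exact (is_derive_mult f g x df dg Hf Hg Rmult_comm). Qed.

Lemma is_derive_rrising (x : R) (m : nat) : real_domain x ->
  is_derive (fun y => rrising y m) x (rrising x m * pole_sum x m).
Proof.
  intros H. induction m as [|m IH].
  - simpl. rewrite Rmult_0_r. apply (is_derive_const (V := R_NormedModule)).
  - assert (Hm := H m). simpl.
    evar_last.
    { apply (is_derive_Rmult _ _ _ _ _ IH (is_derive_shift (INR m) x)). }
    simpl. field. lra.
Qed.

(** [shift] depends on the point; freezing it as [m] gives a function that can be differentiated. *)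
Definition real_Gamma (m : nat) (x : R) : R := gamma_int 0 (x + INR m) / rrising x m.

Lemma real_Gamma_neq_0 (m : nat) (x : R) : real_domain x -> 0 < x + INR m ->
  real_Gamma m x <> 0.
Proof.
  intros H Hm. unfold real_Gamma, Rdiv.
  apply Rmult_integral_contrapositive. split.
  - apply Rgt_not_eq. now apply gamma_int_0_pos.
  - apply Rinv_neq_0_compat. now apply rrising_neq_0.
Qed.

Lemma is_derive_real_Gamma (m : nat) (x : R) : real_domain x -> 0 < x + INR m ->
  is_derive (real_Gamma m) x
    (real_Gamma m x * (log_der (x + INR m) - pole_sum x m)).
Proof.
  intros H Hm. assert (Hr := rrising_neq_0 x m H). assert (HG := gamma_int_0_pos _ Hm).
  unfold real_Gamma. evar_last.
  { apply is_derive_div; [| apply is_derive_rrising; auto | auto].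
    apply (is_derive_comp (gamma_int 0) (fun y => y + INR m)).
    - now apply is_derive_gamma_int.
    - apply is_derive_shift. }
  unfold log_der, scal; simpl; unfold mult; simpl. field. split; lra || auto.
Qed.

(** [shift] jumps only at poles, so near [x] the function [Gamma] coincides with a single
    [real_Gamma m]. *)
Lemma shift_RtoC_locally (x : R) : real_domain x ->
  0 < x + INR (shift (RtoC x)) /\
  exists d, 0 < d /\ forall y, Rabs (y - x) < d -> real_domain y /\ shift (RtoC y) = shift (RtoC x).
Proof.
  intros H.
  assert (Hpos : forall y, 0 < y -> real_domain y /\ shift (RtoC y) = O).
  { intros y Hy. split.
    - intros n ->. assert (P := pos_INR n). lra.
    - unfold shift; simpl. destruct (archimed (- y)) as [_ U].
      assert (L : (up (- y) < 1)%Z) by (apply lt_IZR; lra). lia. }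
  destruct (Rtotal_order 0 x) as [Hx|[Hx|Hx]].
  - split.
    + rewrite (proj2 (Hpos x Hx)); simpl; lra.
    + exists x; split; auto. intros y Hy. apply Rabs_def2 in Hy.
      destruct (Hpos y ltac:(lra)) as [D1 D2]. destruct (Hpos x Hx) as [_ D3].
      split; congruence || auto.
  - exfalso. apply (H O). simpl; lra.
  - destruct (archimed (- x)) as [U1 U2].
    set (k := up (- x)) in *.
    assert (Hk : (0 < k)%Z) by (apply lt_IZR; lra).
    (* The value 1, which [up] allows, would force x = -(k - 1), a pole. *)
    assert (Hne : IZR k - - x <> 1).
    { intros E. apply (H (Z.to_nat (k - 1))).
      rewrite INR_IZR_INZ, Z2Nat.id by lia. rewrite minus_IZR. lra. }
    assert (Hs : shift (RtoC x) = Z.to_nat k) by reflexivity.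
    rewrite Hs, INR_IZR_INZ, Z2Nat.id by lia. split. lra.
    (* The distance from [x] to the nearer of the poles -k and 1 - k. *)
    exists (Rmin (x + IZR k) (1 - IZR k - x)). split. apply Rmin_glb_lt; lra.
    intros y Hy.
    assert (Hy1 := Rlt_le_trans _ _ _ Hy (Rmin_l _ _)).
    assert (Hy2 := Rlt_le_trans _ _ _ Hy (Rmin_r _ _)).
    apply Rabs_def2 in Hy1. apply Rabs_def2 in Hy2.
    split.
    + intros n ->. rewrite INR_IZR_INZ in *.
      assert (Z.of_nat n < k)%Z by (apply lt_IZR; lra).
      assert (k - 1 < Z.of_nat n)%Z by (apply lt_IZR; rewrite minus_IZR; lra). lia.
    + unfold shift; simpl. f_equal. symmetry. apply tech_up; lra.
Qed.

Lemma Gamma_RtoC (x : R) : real_domain x ->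
  Gamma (RtoC x) = RtoC (real_Gamma (shift (RtoC x)) x).
Proof.
  intros H. unfold Gamma, real_Gamma.
  rewrite <- RtoC_plus, EulerIntegral_RtoC, rising_RtoC, RtoC_div; auto.
  now apply rrising_neq_0. now apply shift_RtoC_locally.
Qed.

Lemma C_derive_RtoC (f : C -> C) (g : R -> R) (x d l : R) : 0 < d ->
  (forall y, Rabs (y - x) < d -> f (RtoC y) = RtoC (g y)) ->
  is_derive g x l -> C_derive f (RtoC x) = RtoC l.
Proof.
  intros Hd Hf Hg. unfold C_derive, C_lim.
  assert (Hx : f (RtoC x) = RtoC (g x)).
  { apply Hf. rewrite Rminus_diag, Rabs_R0. exact Hd. }
  assert (E : forall y, y <> x -> Rabs (y - x) < d ->
     ((f (RtoC y) - f (RtoC x)) / (RtoC y - RtoC x))%C = RtoC ((g y - g x) / (y - x))).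
  { intros y Hy Hyd. rewrite Hf, Hx by auto.
    now rewrite RtoC_div, !RtoC_minus by lra. }
  assert (L1 : is_lim (fun y => (g y - g x) / (y - x)) x l).
  { apply is_lim_spec. intros eps. apply is_derive_Reals in Hg.
    destruct (Hg eps (cond_pos eps)) as [d' Hd'].
    exists d'. refine (fun (y : R) Hy Hne => _).
    specialize (Hd' (y - x) ltac:(lra) Hy).
    replace (x + (y - x)) with y in Hd' by ring. exact Hd'. }
  assert (Hloc : forall P : R -> Prop, (forall y, y <> x -> Rabs (y - x) < d -> P y) ->
     Rbar_locally' x P).
  { intros P HP. exists (mkposreal d Hd). intros y Hy Hne. now apply HP. }
  change (RtoC l) with (real (Finite l), real (Finite 0)).
  apply (f_equal2 pair); f_equal; apply is_lim_unique.
  - apply is_lim_ext_loc with (2 := L1). apply Hloc. intros y Hy Hyd.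
    change (y, snd (RtoC x)) with (RtoC y). now rewrite E.
  - apply is_lim_ext_loc with (2 := is_lim_const 0 x). apply Hloc. intros y Hy Hyd.
    change (y, snd (RtoC x)) with (RtoC y). now rewrite E.
Qed.

Lemma Digamma_RtoC (x v : R) : real_domain x ->
  is_lim_seq (fun N => psi_part N x) v -> Digamma (RtoC x) = RtoC v.
Proof.
  intros H Hv. destruct (shift_RtoC_locally x H) as [Hm (d & Hd & Hs)].
  set (m := shift (RtoC x)) in *.
  assert (Ev : v = log_der (x + INR m) - pole_sum x m).
  { apply is_lim_seq_unique in Hv.
    rewrite (is_lim_seq_unique _ _ (is_lim_psi_part x m Hm)) in Hv. congruence. }
  unfold Digamma.
  rewrite (C_derive_RtoC Gamma (real_Gamma m) x d _ Hd) with (2 := is_derive_real_Gamma m x H Hm).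
  - rewrite Gamma_RtoC by auto. fold m. rewrite <- RtoC_div by now apply real_Gamma_neq_0.
    f_equal. subst v. field. now apply real_Gamma_neq_0.
  - intros y Hy. destruct (Hs y Hy) as [D1 D2]. rewrite Gamma_RtoC, D2 by auto. reflexivity.
Qed.

Lemma ex_lim_psi_part (x : R) : real_domain x -> exists v, is_lim_seq (fun N => psi_part N x) (Finite v).
Proof.
  intros H. destruct (shift_RtoC_locally x H) as [Hm _].
  exists (log_der (x + INR (shift (RtoC x))) - pole_sum x (shift (RtoC x))).
  now apply is_lim_psi_part.
Qed.

Lemma is_Digamma_zero_RtoC (x : R) : is_Digamma_zero (RtoC x) <->
  real_domain x /\ is_lim_seq (fun N => psi_part N x) 0.
Proof.
  unfold is_Digamma_zero. rewrite Digamma_domain_RtoC. split; intros [H1 H2]; split; auto.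
  - destruct (ex_lim_psi_part x H1) as [v Hv].
    rewrite (Digamma_RtoC x v) in H2 by auto. apply RtoC_inj in H2. now subst.
  - now apply Digamma_RtoC.
Qed.

(** * The Basel problem *)

(** Exactly [n] terms, against [n + 1] in [sum_n], so empty sums and splittings need no offset. *)
Fixpoint rsum (f : nat -> R) (n : nat) : R :=
  match n with O => 0 | S k => rsum f k + f k end.

Lemma rsum_sum_n (f : nat -> R) (n : nat) : sum_n f n = rsum f (S n).
Proof.
  induction n as [|n IH].
  - rewrite sum_O. simpl. ring.
  - rewrite sum_n_S, IH. reflexivity.
Qed.

Lemma rsum_ext (f g : nat -> R) (n : nat) :
  (forall k, (k < n)%nat -> f k = g k) -> rsum f n = rsum g n.
Proof.
  intros H. induction n as [|n IH]; simpl; auto.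
  rewrite IH by (intros; apply H; lia). rewrite H by lia. reflexivity.
Qed.

Lemma rsum_le (f g : nat -> R) (n : nat) :
  (forall k, (k < n)%nat -> f k <= g k) -> rsum f n <= rsum g n.
Proof.
  intros H. induction n as [|n IH]; simpl. lra.
  apply Rplus_le_compat; [apply IH; intros; apply H; lia | apply H; lia].
Qed.

Lemma rsum_plus (f g : nat -> R) (n : nat) :
  rsum (fun k => f k + g k) n = rsum f n + rsum g n.
Proof. induction n as [|n IH]; simpl; [|rewrite IH]; ring. Qed.

Lemma rsum_scal (c : R) (f : nat -> R) (n : nat) :
  rsum (fun k => c * f k) n = c * rsum f n.
Proof. induction n as [|n IH]; simpl; [|rewrite IH]; ring. Qed.

Lemma rsum_const (c : R) (n : nat) : rsum (fun _ => c) n = INR n * c.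
Proof. induction n as [|n IH]; [simpl; ring|]. rewrite S_INR. simpl. rewrite IH. ring. Qed.

Lemma rsum_add (f : nat -> R) (n m : nat) :
  rsum f (n + m) = rsum f n + rsum (fun k => f (n + k)%nat) m.
Proof.
  induction m as [|m IH].
  - rewrite Nat.add_0_r. simpl. ring.
  - rewrite Nat.add_succ_r. simpl. rewrite IH. ring.
Qed.

Lemma rsum_rev (f : nat -> R) (n : nat) : rsum f n = rsum (fun k => f (n - 1 - k)%nat) n.
Proof.
  induction n as [|n IH]; auto.
  change (rsum f n + f n = rsum (fun k => f (S n - 1 - k)%nat) (1 + n)).
  rewrite rsum_add, IH.
  change (rsum (fun k => f (S n - 1 - k)%nat) 1) with (0 + f (S n - 1 - 0)%nat).
  replace (S n - 1 - 0)%nat with n by lia. rewrite Rplus_0_l, Rplus_comm. f_equal.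
  apply rsum_ext. intros k Hk. f_equal. lia.
Qed.

Lemma rsum_mono (f : nat -> R) (n m : nat) :
  (forall k, 0 <= f k) -> (n <= m)%nat -> rsum f n <= rsum f m.
Proof. intros H. induction 1; simpl. lra. specialize (H m). lra. Qed.

(* The angles are k PI / (2 M) for 0 < k < M, where M = m + 1. *)
Definition csc2_sum (m : nat) : R :=
  rsum (fun k => / sin (INR (S k) * PI / (2 * INR (S m))) ^ 2) m.

Lemma csc2_double (x : R) : 0 < x < PI / 2 ->
  / sin x ^ 2 + / sin (PI / 2 - x) ^ 2 = 4 * / sin (2 * x) ^ 2.
Proof.
  intros H. rewrite sin_shift, sin_2a.
  assert (0 < sin x) by (apply sin_gt_0; lra).
  assert (0 < cos x) by (apply cos_gt_0; lra).
  assert (E := sin2_cos2 x). unfold Rsqr in E.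
  transitivity ((sin x * sin x + cos x * cos x) / (sin x ^ 2 * cos x ^ 2)).
  field; lra. rewrite E. field; lra.
Qed.

Lemma angle_bounds (a M : R) : 0 < a < M -> 0 < a * PI / (2 * M) < PI / 2.
Proof.
  intros H. assert (P := PI_RGT_0). split. apply Rdiv_lt_0_compat; nra.
  apply Rmult_lt_reg_r with (2 * M). lra.
  replace (a * PI / (2 * M) * (2 * M)) with (a * PI) by (field; lra). nra.
Qed.

(** Passing from M to 2M halves the old angles and adds new ones. Angles below and above PI/4 pair
    up under x -> PI/2 - x, each pair giving one old term by [csc2_double]; the middle angle PI/4
    adds 2. *)
Lemma csc2_sum_double (m : nat) : csc2_sum (m + S m) = 4 * csc2_sum m + 2.
Proof.
  unfold csc2_sum at 1. set (M := INR (S m)).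
  assert (P := PI_RGT_0). assert (Pm := pos_INR m).
  assert (HM : M = INR m + 1) by apply S_INR.
  assert (E : INR (S (m + S m)) = 2 * M) by (rewrite S_INR, plus_INR; fold M; lra).
  rewrite E. set (g := fun k => / sin (INR (S k) * PI / (2 * (2 * M))) ^ 2).
  change (rsum g (m + (1 + m)) = 4 * csc2_sum m + 2).
  rewrite rsum_add, rsum_add.
  rewrite (rsum_rev (fun k => g (m + (1 + k))%nat) m).
  change (rsum (fun k => g (m + k)%nat) 1) with (0 + g (m + 0)%nat).
  unfold g at 2.
  replace (INR (S (m + 0)) * PI / (2 * (2 * M))) with (PI / 4)
    by (rewrite Nat.add_0_r; fold M; field; lra).
  rewrite sin_PI4.
  replace (/ (1 / sqrt 2) ^ 2) with 2.
  2:{ assert (H2 := sqrt_lt_R0 2 ltac:(lra)).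
      replace ((1 / sqrt 2) ^ 2) with (/ (sqrt 2 * sqrt 2)) by (field; lra).
      rewrite sqrt_sqrt by lra. field. }
  rewrite Rplus_0_l. unfold csc2_sum. fold M.
  rewrite <- rsum_scal.
  match goal with |- ?a + (2 + ?b) = _ => replace (a + (2 + b)) with (a + b + 2) by ring end.
  f_equal. rewrite <- rsum_plus. apply rsum_ext. intros k Hk. unfold g.
  set (x := INR (S k) * PI / (2 * (2 * M))).
  assert (Hk' : INR (S k) < M) by (apply lt_INR; lia).
  assert (Hk0 : 0 < INR (S k)) by (apply lt_0_INR; lia).
  assert (Hx : 0 < x < PI / 2).
  { unfold x. apply angle_bounds. lra. }
  replace (INR (S (m + (1 + (m - 1 - k)))) * PI / (2 * (2 * M))) with (PI / 2 - x).
  2:{ unfold x. replace (S (m + (1 + (m - 1 - k)))) with (S m + (S m - S k))%nat by lia.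
      rewrite plus_INR, minus_INR by lia. fold M. field. lra. }
  rewrite csc2_double by auto. do 3 f_equal. f_equal. unfold x. field. lra.
Qed.

(** Doubling reaches only M = 2^j, which suffices because the partial sums in [Basel] are
    monotone. *)
Lemma csc2_sum_pow2 (n : nat) : exists m, (n <= m)%nat /\
  csc2_sum m = (2 * INR (S m) ^ 2 - 2) / 3.
Proof.
  induction n as [|n (m & H & E)].
  - exists O. split; auto. unfold csc2_sum. simpl. field.
  - exists (m + S m)%nat. split. lia.
    rewrite csc2_sum_double, E. rewrite !S_INR, plus_INR, S_INR. field.
Qed.

Lemma x_cos_le_sin (x : R) : 0 < x < PI / 2 -> x * cos x <= sin x.
Proof.
  intros H.
  destruct (MVT_gen (fun x => sin x - x * cos x) 0 x (fun x => x * sin x)) as (c & Hc & E).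
  - intros y _. auto_derive; auto. ring.
  - intros y _. apply derivable_continuous_pt. apply ex_derive_Reals_0. auto_derive; auto.
  - rewrite Rmin_left, Rmax_right in Hc by lra. rewrite sin_0 in E.
    assert (0 <= sin c) by (apply sin_ge_0; lra).
    assert (0 <= c * sin c * (x - 0)) by (repeat apply Rmult_le_pos; lra). lra.
Qed.

(** The lower bound is sin x < x; the upper one is cot x <= 1/x with csc^2 = cot^2 + 1. *)
Lemma csc2_bounds (x : R) : 0 < x < PI / 2 -> / x ^ 2 <= / sin x ^ 2 <= / x ^ 2 + 1.
Proof.
  intros H.
  assert (0 < sin x) by (apply sin_gt_0; lra).
  assert (0 < cos x) by (apply cos_gt_0; lra).
  assert (sin x < x) by (apply sin_lt_x; lra).
  assert (A := x_cos_le_sin x H).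
  split. apply Rinv_le_contravar; nra.
  assert (E := sin2_cos2 x). unfold Rsqr in E.
  replace (/ sin x ^ 2) with ((cos x / sin x) ^ 2 + 1).
  2:{ transitivity ((sin x * sin x + cos x * cos x) / sin x ^ 2). field; lra.
      rewrite E. field; lra. }
  apply Rplus_le_compat_r. rewrite <- pow_inv.
  apply pow_incr. split. apply Rlt_le, Rdiv_lt_0_compat; lra.
  apply Rmult_le_reg_r with (x * sin x). nra. field_simplify; lra.
Qed.

Lemma Basel : is_lim_seq (rsum (fun k => / INR (S k) ^ 2)) (PI ^ 2 / 6).
Proof.
  assert (P := PI_RGT_0).
  set (f := fun k => / INR (S k) ^ 2).
  assert (Hf : forall k, 0 <= f k).
  { intros k. apply Rlt_le, Rinv_0_lt_compat, pow_lt, lt_0_INR. lia. }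
  (* At x = k PI/(2M) one has 1/x^2 = c/k^2 with c = 4 M^2/PI^2, so summing [csc2_bounds] confines
     the partial sum to a window of width O(1/M). *)
  assert (Key : forall m, csc2_sum m = (2 * INR (S m) ^ 2 - 2) / 3 ->
    PI ^ 2 / 6 - PI ^ 2 / INR (S m) <= rsum f m <= PI ^ 2 / 6).
  { intros m E. set (M := INR (S m)) in *.
    assert (HM : M = INR m + 1) by apply S_INR. assert (Pm := pos_INR m).
    set (c := 4 * M ^ 2 / PI ^ 2).
    assert (Hc : 0 < c) by (apply Rdiv_lt_0_compat; nra).
    assert (Hk : forall k, (k < m)%nat ->
      c * f k <= / sin (INR (S k) * PI / (2 * M)) ^ 2 <= c * f k + 1).
    { intros k Hk. assert (Hk' : INR (S k) < M) by (apply lt_INR; lia).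
      assert (Hk0 : 0 < INR (S k)) by (apply lt_0_INR; lia).
      replace (c * f k) with (/ (INR (S k) * PI / (2 * M)) ^ 2)
        by (unfold c, f; field; lra).
      apply csc2_bounds, angle_bounds. lra. }
    assert (L := rsum_le _ _ m (fun k Hk0 => proj1 (Hk k Hk0))).
    assert (U := rsum_le _ _ m (fun k Hk0 => proj2 (Hk k Hk0))).
    rewrite rsum_plus, rsum_const in U. rewrite rsum_scal in L, U.
    fold M in L, U. unfold csc2_sum in E. fold M in E. rewrite E in L, U.
    assert (Ec : forall s, c * s = 4 * M ^ 2 / PI ^ 2 * s) by reflexivity.
    split.
    - apply Rmult_le_reg_l with c; auto.
      replace (c * (PI ^ 2 / 6 - PI ^ 2 / M)) with (2 * M ^ 2 / 3 - 4 * M)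
        by (unfold c; field; lra). nra.
    - apply Rmult_le_reg_l with c; auto.
      replace (c * (PI ^ 2 / 6)) with (2 * M ^ 2 / 3) by (unfold c; field; lra). nra. }
  apply is_lim_seq_spec. intros eps.
  destruct (nfloor_ex (PI ^ 2 / eps)) as [n [_ Hn]].
  { apply Rlt_le, Rdiv_lt_0_compat; [nra | apply cond_pos]. }
  destruct (csc2_sum_pow2 n) as (m & Hm & E).
  exists m. intros k Hk.
  (* [k] lies between the good indices [m] and [m']: the first gives the lower bound, the second the
     upper. *)
  destruct (csc2_sum_pow2 k) as (m' & Hm' & E').
  assert (rsum f m <= rsum f k) by now apply rsum_mono.
  assert (rsum f k <= rsum f m') by now apply rsum_mono.
  destruct (Key m E) as [L _]. destruct (Key m' E') as [_ U].
  assert (Heps := cond_pos eps).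
  assert (PI ^ 2 / INR (S m) < eps).
  { assert (INR n <= INR m) by now apply le_INR. rewrite S_INR. assert (Pm := pos_INR m).
    apply Rmult_lt_reg_r with ((INR m + 1) / eps). apply Rdiv_lt_0_compat; lra.
    replace (PI ^ 2 / (INR m + 1) * ((INR m + 1) / eps)) with (PI ^ 2 / eps) by (field; lra).
    replace (eps * ((INR m + 1) / eps)) with (INR m + 1) by (field; lra). lra. }
  apply Rabs_def1; lra.
Qed.

(** * Zeros between consecutive poles *)

Definition psi_term (z : R) (n : nat) : R := / INR (S n) - / (z + INR n).

Lemma psi_part_rsum (N : nat) (z : R) :
  psi_part N z = - EulerGamma + rsum (psi_term z) (S N).
Proof. unfold psi_part. now rewrite rsum_sum_n. Qed.

(** The intervals between poles, numbered from the right so that alpha_k will fall in cell [k]; cell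
    0 is the half-line (0, oo). *)
Definition cell (k : nat) (x : R) : Prop := - INR k < x /\ (k = O \/ x < 1 - INR k).

Lemma cell_pos (k n : nat) (x : R) : cell k x -> (k <= n)%nat -> 0 < x + INR n.
Proof. intros [H _] Hn. apply le_INR in Hn. lra. Qed.

Lemma cell_neg (k n : nat) (x : R) : cell k x -> (n < k)%nat -> x + INR n < 0.
Proof.
  intros [_ [->|H]] Hn. lia.
  assert (INR (S n) <= INR k) by (apply le_INR; lia). rewrite S_INR in *. lra.
Qed.

Lemma cell_mul_pos (k n : nat) (a b : R) : cell k a -> cell k b ->
  0 < (a + INR n) * (b + INR n).
Proof.
  intros Ha Hb. destruct (Nat.lt_ge_cases n k) as [H|H].
  - assert (A1 := cell_neg k n a Ha H). assert (A2 := cell_neg k n b Hb H). nra.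
  - apply Rmult_lt_0_compat; eapply cell_pos; eauto.
Qed.

Lemma cell_neq (k n : nat) (x : R) : cell k x -> x + INR n <> 0.
Proof. intros H E. assert (P := cell_mul_pos k n x x H H). rewrite E in P. lra. Qed.

Lemma cell_real_domain (k : nat) (x : R) : cell k x -> real_domain x.
Proof. intros H n ->. apply (cell_neq k n _ H). lra. Qed.

Lemma cell_between (k : nat) (a b x : R) : cell k a -> cell k b -> a <= x <= b -> cell k x.
Proof. intros [A1 A2] [B1 B2] H. split. lra. destruct B2; [left|right]; auto; lra. Qed.

Lemma cell_lt (i k : nat) (x y : R) : (i < k)%nat -> cell i x -> cell k y -> y < x.
Proof.
  intros H [Hx _] [_ [->|Hy]]. lia.
  assert (INR (S i) <= INR k) by (apply le_INR; lia). rewrite S_INR in *. lra.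
Qed.

Lemma cell_S_neg (k : nat) (x : R) : cell (S k) x -> x < 0.
Proof.
  intros [_ [H|H]]. discriminate. rewrite S_INR in H. assert (P := pos_INR k). lra.
Qed.

Lemma ex_cell (x : R) : real_domain x -> exists k, cell k x.
Proof.
  intros H. destruct (Rlt_le_dec 0 x) as [Hx|Hx].
  - exists O. split; simpl; auto. lra.
  - destruct (nfloor_ex (- x)) as [n [H1 H2]]. lra.
    exists (S n). split.
    + rewrite S_INR. lra.
    + right. rewrite S_INR. specialize (H n). lra.
Qed.

Lemma cell_open (k : nat) (x : R) : cell k x -> exists d, 0 < d /\ forall y, Rabs (y - x) <= d -> cell k y.
Proof.
  intros [H1 H2]. destruct H2 as [->|H2].
  - exists (x / 2). simpl in *. split. lra.
    intros y Hy. apply Rabs_le_between in Hy. split; auto. simpl. lra.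
  - set (d := Rmin (x + INR k) (1 - INR k - x) / 2).
    assert (D1 := Rmin_l (x + INR k) (1 - INR k - x)).
    assert (D2 := Rmin_r (x + INR k) (1 - INR k - x)).
    assert (D3 : 0 < Rmin (x + INR k) (1 - INR k - x)) by (apply Rmin_glb_lt; lra).
    exists d. unfold d. split. lra.
    intros y Hy. apply Rabs_le_between in Hy. split. lra. right; lra.
Qed.

Lemma psi_part_diff (k N : nat) (a b : R) : cell k a -> cell k b ->
  psi_part N b - psi_part N a = rsum (fun n => / (a + INR n) - / (b + INR n)) (S N).
Proof.
  intros Ha Hb. rewrite !psi_part_rsum.
  transitivity (rsum (psi_term b) (S N) + -1 * rsum (psi_term a) (S N)). ring.
  rewrite <- rsum_scal, <- rsum_plus. apply rsum_ext. intros n _.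
  unfold psi_term. ring.
Qed.

Lemma inv_diff (a b : R) : a <> 0 -> b <> 0 -> / a - / b = (b - a) * / (a * b).
Proof. intros. field; auto. Qed.

Lemma cell_inv_diff_ge (k n : nat) (a b : R) : cell k a -> cell k b -> a <= b ->
  0 <= / (a + INR n) - / (b + INR n).
Proof.
  intros Ha Hb H. rewrite inv_diff by (eapply cell_neq; eauto).
  apply Rmult_le_pos. lra.
  apply Rlt_le, Rinv_0_lt_compat. eapply cell_mul_pos; eauto.
Qed.

Lemma rsum_ge_term (f : nat -> R) (n m : nat) :
  (forall k, 0 <= f k) -> (m < n)%nat -> f m <= rsum f n.
Proof.
  intros H Hm. apply Rle_trans with (rsum f (S m)).
  - simpl. assert (P := rsum_mono f 0 m H (Nat.le_0_l m)). simpl in P. lra.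
  - now apply rsum_mono.
Qed.

Lemma psi_part_diff_ge (k N m : nat) (a b : R) : cell k a -> cell k b -> a <= b -> (m <= N)%nat ->
  / (a + INR m) - / (b + INR m) <= psi_part N b - psi_part N a.
Proof.
  intros Ha Hb H Hm. rewrite (psi_part_diff k) by auto.
  apply (rsum_ge_term (fun n => / (a + INR n) - / (b + INR n))); [|lia].
  intros n. now apply (cell_inv_diff_ge k).
Qed.

(** From index [k] on, c + n is positive, and 1/(u + 1)^2 <= 1/u - 1/(u + 1) telescopes. *)
Lemma rsum_inv_sqr_bounded (k : nat) (c : R) : cell k c ->
  exists L, forall N, rsum (fun n => / (c + INR n) ^ 2) N <= L.
Proof.
  intros Hc. set (f := fun n => / (c + INR n) ^ 2).
  assert (Hf : forall n, 0 <= f n).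
  { intros n. apply Rlt_le, Rinv_0_lt_compat, pow2_gt_0. eapply cell_neq; eauto. }
  assert (Hk := cell_pos k k c Hc (Nat.le_refl k)).
  assert (K : forall j, rsum f (S k + j) <= rsum f (S k) + / (c + INR k) - / (c + INR k + INR j)).
  { induction j as [|j IH].
    - rewrite Nat.add_0_r. simpl INR. rewrite Rplus_0_r. lra.
    - rewrite Nat.add_succ_r. change (rsum f (S (S k + j))) with (rsum f (S k + j) + f (S k + j)%nat).
      assert (f (S k + j)%nat <= / (c + INR k + INR j) - / (c + INR k + INR (S j))); [|lra].
      unfold f. rewrite plus_INR, !S_INR. set (u := c + INR k + INR j).
      assert (Pj := pos_INR j).
      replace (c + (INR k + 1 + INR j)) with (u + 1) by (unfold u; ring).
      replace (c + INR k + (INR j + 1)) with (u + 1) by (unfold u; ring).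
      assert (0 < u) by (unfold u; lra).
      replace (/ u - / (u + 1)) with (/ (u * (u + 1))) by (field; lra).
      apply Rinv_le_contravar; nra. }
  exists (rsum f (S k) + / (c + INR k)). intros N.
  apply Rle_trans with (rsum f (S k + N)). apply rsum_mono; auto; lia.
  specialize (K N). assert (0 < / (c + INR k + INR N)).
  { apply Rinv_0_lt_compat. assert (P := pos_INR N). lra. }
  lra.
Qed.

(** 1/((a + n)(b + n)) is largest at the end of [c, e] nearest the pole -n: [e] for n < k, [c] for n
    >= k. Since [L] is independent of [N], the bound passes to the limit [Psi]. *)
Lemma psi_part_lipschitz (k : nat) (c e : R) : cell k c -> cell k e ->
  exists L, forall a b, c <= a -> a <= b -> b <= e ->
    forall N, psi_part N b - psi_part N a <= L * (b - a).
Proof.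
  intros Hc He.
  destruct (rsum_inv_sqr_bounded k c Hc) as [L1 H1].
  destruct (rsum_inv_sqr_bounded k e He) as [L2 H2].
  exists (L1 + L2). intros a b Ha Hab Hb N.
  assert (Ca : cell k a) by (apply (cell_between k c e); auto; lra).
  assert (Cb : cell k b) by (apply (cell_between k c e); auto; lra).
  rewrite (psi_part_diff k) by auto.
  apply Rle_trans with (rsum (fun n => (b - a) * (/ (c + INR n) ^ 2 + / (e + INR n) ^ 2)) (S N)).
  - apply rsum_le. intros n _. rewrite inv_diff by (eapply cell_neq; eauto).
    replace (b + INR n - (a + INR n)) with (b - a) by ring.
    apply Rmult_le_compat_l. lra.
    assert (P1 : 0 < (c + INR n) ^ 2) by (apply pow2_gt_0; eapply cell_neq; eauto).
    assert (P2 : 0 < (e + INR n) ^ 2) by (apply pow2_gt_0; eapply cell_neq; eauto).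
    assert (Q1 := Rinv_0_lt_compat _ P1). assert (Q2 := Rinv_0_lt_compat _ P2).
    destruct (Nat.lt_ge_cases n k) as [H|H].
    + assert (A1 := cell_neg k n e He H).
      apply Rle_trans with (/ (e + INR n) ^ 2); [|lra].
      apply Rinv_le_contravar; nra.
    + assert (A1 := cell_pos k n c Hc H).
      apply Rle_trans with (/ (c + INR n) ^ 2); [|lra].
      apply Rinv_le_contravar; nra.
  - rewrite rsum_scal, rsum_plus. rewrite Rmult_comm.
    apply Rmult_le_compat_r. lra. specialize (H1 (S N)). specialize (H2 (S N)). lra.
Qed.

Definition Psi (x : R) : R := real (Lim_seq (fun N => psi_part N x)).

Lemma is_lim_Psi (x : R) : real_domain x -> is_lim_seq (fun N => psi_part N x) (Psi x).
Proof.
  intros H. destruct (ex_lim_psi_part x H) as [v Hv].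
  unfold Psi. now rewrite (is_lim_seq_unique _ _ Hv).
Qed.

Lemma is_lim_Psi_diff (k : nat) (a b : R) : cell k a -> cell k b ->
  is_lim_seq (fun N => psi_part N b - psi_part N a) (Psi b - Psi a).
Proof.
  intros Ha Hb. apply is_lim_seq_minus'; apply is_lim_Psi; eapply cell_real_domain; eauto.
Qed.

Lemma Psi_diff_ge (k m : nat) (a b : R) : cell k a -> cell k b -> a <= b ->
  / (a + INR m) - / (b + INR m) <= Psi b - Psi a.
Proof.
  intros Ha Hb H.
  apply (is_lim_seq_le_loc (fun _ => / (a + INR m) - / (b + INR m)) _ 
    (Finite (/ (a + INR m) - / (b + INR m))) (Finite (Psi b - Psi a))
    (ex_intro _ m (fun N HN => psi_part_diff_ge k N m a b Ha Hb H HN))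
    (is_lim_seq_const _) (is_lim_Psi_diff k a b Ha Hb)).
Qed.

Lemma Psi_lipschitz (k : nat) (c e : R) : cell k c -> cell k e ->
  exists L, forall a b, c <= a -> a <= b -> b <= e -> Psi b - Psi a <= L * (b - a).
Proof.
  intros Hc He. destruct (psi_part_lipschitz k c e Hc He) as [L HL].
  exists L. intros a b Ha Hab Hb.
  assert (Ca : cell k a) by (apply (cell_between k c e); auto; lra).
  assert (Cb : cell k b) by (apply (cell_between k c e); auto; lra).
  apply (is_lim_seq_le _ (fun _ => L * (b - a)) (Finite (Psi b - Psi a)) (Finite (L * (b - a)))
    (HL a b Ha Hab Hb) (is_lim_Psi_diff k a b Ca Cb) (is_lim_seq_const _)).
Qed.

(** With [cell_steep], this isolates what the existence of zeros requires, so that [Psi] and the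
    truncations share one argument. *)
Definition cell_lipschitz (k : nat) (F : R -> R) : Prop :=
  forall c e, cell k c -> cell k e ->
  exists L, forall a b, c <= a -> a <= b -> b <= e -> F b - F a <= L * (b - a).

(** Equivalently, F(x) + 1/(x + m) is nondecreasing on the cell: [F] rises at least as fast as the
    pole term at -m, hence is unbounded near -m if that is an end of the cell. *)
Definition cell_steep (k m : nat) (F : R -> R) : Prop :=
  forall a b, cell k a -> cell k b -> a <= b -> / (a + INR m) - / (b + INR m) <= F b - F a.

Lemma cell_steep_incr (k m : nat) (F : R -> R) (a b : R) : cell_steep k m F ->
  cell k a -> cell k b -> a < b -> F a < F b.
Proof.
  intros HF Ha Hb H. specialize (HF a b Ha Hb (Rlt_le _ _ H)).
  assert (0 < / (a + INR m) - / (b + INR m)); [|lra].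
  rewrite inv_diff by (eapply cell_neq; eauto).
  apply Rmult_lt_0_compat. lra. apply Rinv_0_lt_compat. eapply cell_mul_pos; eauto.
Qed.

Lemma cell_steep_lt_inv (k m : nat) (F : R -> R) (a b : R) : cell_steep k m F ->
  cell k a -> cell k b -> F a < F b -> a < b.
Proof.
  intros HF Ha Hb H. destruct (Rtotal_order a b) as [?|[->|?]]; auto. lra.
  assert (F b < F a) by (eapply cell_steep_incr; eauto). lra.
Qed.

(** Steepness makes [F] increasing, so the one-sided bound controls the absolute value of its
    increments. *)
Lemma cell_lipschitz_continuity (k m : nat) (F : R -> R) (x : R) :
  cell_lipschitz k F -> cell_steep k m F -> cell k x -> continuity_pt F x.
Proof.
  intros HL HS Hx. destruct (cell_open k x Hx) as (d & Hd & HO).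
  assert (C1 : cell k (x - d)).
  { apply HO. replace (x - d - x) with (- d) by ring. rewrite Rabs_Ropp, Rabs_pos_eq; lra. }
  assert (C2 : cell k (x + d)).
  { apply HO. replace (x + d - x) with d by ring. rewrite Rabs_pos_eq; lra. }
  destruct (HL _ _ C1 C2) as [L H].
  set (K := Rmax L 0 + 1).
  assert (HK : 0 < K) by (assert (A := Rmax_r L 0); unfold K; lra).
  assert (HLK : L <= K) by (assert (A := Rmax_l L 0); unfold K; lra).
  intros eps Heps. exists (Rmin d (eps / K)). split.
  { apply Rmin_glb_lt; auto. now apply Rdiv_lt_0_compat. }
  intros y [_ Hy]. simpl in *. unfold Rdist in *.
  assert (Hy1 := Rlt_le_trans _ _ _ Hy (Rmin_l _ _)).
  assert (Hy2 := Rlt_le_trans _ _ _ Hy (Rmin_r _ _)).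
  assert (Cy : cell k y) by (apply HO; lra).
  assert (HKe : K * Rabs (y - x) < eps).
  { apply Rmult_lt_reg_r with (/ K). now apply Rinv_0_lt_compat.
    replace (K * Rabs (y - x) * / K) with (Rabs (y - x)) by (field; lra). exact Hy2. }
  apply Rabs_def2 in Hy1.
  destruct (Rtotal_order x y) as [Hxy|[->|Hxy]].
  - assert (A := H x y ltac:(lra) ltac:(lra) ltac:(lra)).
    assert (B := cell_steep_incr k m F x y HS Hx Cy Hxy).
    rewrite (Rabs_pos_eq (y - x)) in HKe by lra. rewrite Rabs_pos_eq by lra. nra.
  - rewrite Rminus_diag, Rabs_R0. lra.
  - assert (A := H y x ltac:(lra) ltac:(lra) ltac:(lra)).
    assert (B := cell_steep_incr k m F y x HS Cy Hx Hxy).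
    rewrite (Rabs_left (y - x)) in HKe by lra. rewrite Rabs_left by lra. nra.
Qed.

Lemma cell_IVT (k m : nat) (F : R -> R) (a b : R) :
  cell_lipschitz k F -> cell_steep k m F -> cell k a -> cell k b ->
  F a < 0 -> 0 < F b -> exists x, cell k x /\ F x = 0.
Proof.
  intros HL HS Ha Hb H1 H2.
  assert (a < b) by (eapply cell_steep_lt_inv; eauto; lra).
  destruct (IVT_interv F a b) as (x & Hx & E); auto.
  - intros x Hx. apply (cell_lipschitz_continuity k m); auto. now apply (cell_between k a b).
  - exists x. split; auto. now apply (cell_between k a b).
Qed.

(* Steepness at both end points of the cell forces F to -oo on the left and to +oo on the right. *)
Lemma ex_zero_in_cell (k : nat) (F : R -> R) :
  cell_lipschitz (S k) F -> cell_steep (S k) k F -> cell_steep (S k) (S k) F ->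
  exists x, cell (S k) x /\ F x = 0.
Proof.
  intros HL H1 H2.
  set (c := - INR k - / 2).
  assert (Hc : forall e, 0 < e < 1 -> cell (S k) (- INR k - e)).
  { intros e He. split; [|right]; rewrite S_INR; lra. }
  assert (Cc : cell (S k) c) by (apply Hc; lra).
  (* At distance [e] from an end the pole term has size |F c| + 3, at the midpoint [c] it has size
     2; the gain |F c| + 1 outweighs [F c]. *)
  set (e := / (Rabs (F c) + 3)).
  assert (Pc := Rabs_pos (F c)).
  assert (He : 0 < e < / 2).
  { unfold e. split. apply Rinv_0_lt_compat; lra. apply Rinv_lt_contravar; lra. }
  assert (Ee : / e = Rabs (F c) + 3) by (unfold e; now rewrite Rinv_inv).
  assert (Ca : cell (S k) (- INR k - (1 - e))) by (apply Hc; lra).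
  assert (Cb : cell (S k) (- INR k - e)) by (apply Hc; lra).
  assert (A := H2 _ _ Ca Cc ltac:(unfold c; lra)).
  assert (B := H1 _ _ Cc Cb ltac:(unfold c; lra)).
  rewrite S_INR in A.
  replace (- INR k - (1 - e) + (INR k + 1)) with e in A by ring.
  replace (c + (INR k + 1)) with (/ 2) in A by (unfold c; field).
  replace (- INR k - e + INR k) with (- e) in B by ring.
  replace (c + INR k) with (- / 2) in B by (unfold c; ring).
  rewrite !Rinv_opp, Rinv_inv in B. rewrite Rinv_inv in A. rewrite Ee in A, B.
  assert (D := Rle_abs (F c)). assert (D' := Rle_abs (- F c)). rewrite Rabs_Ropp in D'.
  apply (cell_IVT (S k) k F _ _ HL H1 Ca Cb); lra.
Qed.

Lemma psi_part_1 (N : nat) : psi_part N 1 = - EulerGamma.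
Proof.
  rewrite psi_part_rsum.
  rewrite (rsum_ext _ (fun _ => 0)). rewrite rsum_const. ring.
  intros n _. unfold psi_term. rewrite S_INR, (Rplus_comm 1). ring.
Qed.

Lemma psi_part_2 (N : nat) : psi_part N 2 = 1 - EulerGamma - / (INR N + 2).
Proof.
  rewrite psi_part_rsum. 
  assert (E : forall n, rsum (psi_term 2) n = 1 - / (INR n + 1)).
  { induction n as [|n IH]. simpl. field. simpl rsum. rewrite IH. unfold psi_term.
    rewrite !S_INR. assert (P := pos_INR n). field. lra. }
  rewrite E, S_INR. replace (INR N + 1 + 1) with (INR N + 2) by ring. ring.
Qed.

Lemma cell_0 (x : R) : 0 < x -> cell 0 x.
Proof. intros H. split; simpl; auto. lra. Qed.

Lemma Psi_1 : Psi 1 = - EulerGamma.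
Proof.
  unfold Psi. rewrite (Lim_seq_ext _ _ psi_part_1), Lim_seq_const. reflexivity.
Qed.

Lemma Psi_2 : Psi 2 = 1 - EulerGamma.
Proof.
  unfold Psi. rewrite (Lim_seq_ext _ _ psi_part_2).
  assert (L := is_lim_seq_minus' _ _ _ _ (is_lim_seq_const (1 - EulerGamma)) (is_lim_seq_inv_shift 1 2)).
  rewrite (Lim_seq_ext _ (fun N => 1 - EulerGamma - 1 / (2 + INR N))).
  - rewrite (is_lim_seq_unique _ _ L). simpl. ring.
  - intros n. rewrite (Rplus_comm 2). unfold Rdiv. now rewrite Rmult_1_l.
Qed.

Lemma ex_Psi_zero (k : nat) : exists x, cell k x /\ Psi x = 0.
Proof.
  assert (HL : forall k, cell_lipschitz k Psi) by (intros j c e; apply Psi_lipschitz).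
  assert (HS : forall k m, cell_steep k m Psi) by (intros j m a b; apply Psi_diff_ge).
  assert (G := EulerGamma_bounds).
  destruct k as [|k].
  - apply (cell_IVT 0 0 Psi 1 2); auto; try (apply cell_0; lra).
    rewrite Psi_1; lra. rewrite Psi_2; lra.
  - now apply ex_zero_in_cell.
Qed.

(** For 1 <= k <= N both ends of cell [k] are poles of the truncation. In cell 0 the sign change is
    between 1 and 2, and the sign at 2 is right only for large [N]. *)
Lemma ex_psi_part_zero (N k : nat) : (k <= N)%nat -> 0 < psi_part N 2 ->
  exists x, cell k x /\ psi_part N x = 0.
Proof.
  intros Hk H2.
  assert (HL : forall k, cell_lipschitz k (psi_part N)).
  { intros j c e Hc He. destruct (psi_part_lipschitz j c e Hc He) as [L HL].
    exists L. intros; auto. }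
  assert (HS : forall k m, (m <= N)%nat -> cell_steep k m (psi_part N))
    by (intros j m Hm a b; intros; now apply (psi_part_diff_ge j)).
  assert (G := EulerGamma_bounds).
  destruct k as [|k].
  - apply (cell_IVT 0 0 (psi_part N) 1 2); auto; try (apply cell_0; lra).
    rewrite psi_part_1; lra.
  - apply ex_zero_in_cell; auto; apply HS; lia.
Qed.

(** * Roots of the truncated series *)

(** Polynomial functions of degree at most [n] in Horner form, so that division by z - a goes by
    induction on [n]. *)
Fixpoint is_poly (n : nat) (f : R -> R) : Prop :=
  match n with
  | O => exists c, forall z, f z = c
  | S m => exists c g, is_poly m g /\ forall z, f z = c + z * g z
  end.

Lemma is_poly_ext (n : nat) (f g : R -> R) : (forall z, f z = g z) -> is_poly n f -> is_poly n g.
Proof.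
  intros E. destruct n; simpl.
  - intros [c H]. exists c. intros z. now rewrite <- E.
  - intros (c & h & Hh & H). exists c, h. split; auto. intros z. now rewrite <- E.
Qed.

Lemma is_poly_S (n : nat) (f : R -> R) : is_poly n f -> is_poly (S n) f.
Proof.
  revert f. induction n as [|n IH]; intros f.
  - intros [c H]. exists c, (fun _ => 0). split.
    + exists 0. reflexivity.
    + intros z. rewrite H. ring.
  - intros (c & g & Hg & H). exists c, g. split; [now apply IH | exact H].
Qed.

Lemma is_poly_plus (n : nat) (f g : R -> R) :
  is_poly n f -> is_poly n g -> is_poly n (fun z => f z + g z).
Proof.
  revert f g. induction n as [|n IH]; intros f g.
  - intros [c H] [d K]. exists (c + d). intros z. now rewrite H, K.
  - intros (c & f' & Hf & H) (d & g' & Hg & K).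
    exists (c + d), (fun z => f' z + g' z). split; [now apply IH|].
    intros z. rewrite H, K. ring.
Qed.

Lemma is_poly_scal (n : nat) (a : R) (f : R -> R) : is_poly n f -> is_poly n (fun z => a * f z).
Proof.
  revert f. induction n as [|n IH]; intros f.
  - intros [c H]. exists (a * c). intros z. now rewrite H.
  - intros (c & f' & Hf & H). exists (a * c), (fun z => a * f' z). split; [now apply IH|].
    intros z. rewrite H. ring.
Qed.

Lemma is_poly_mul_affine (n : nat) (a b : R) (f : R -> R) :
  is_poly n f -> is_poly (S n) (fun z => f z * (a * z + b)).
Proof.
  intros Hf. apply is_poly_ext with (fun z => (0 + z * (a * f z)) + b * f z).
  intros; ring. apply is_poly_plus.
  - exists 0, (fun z => a * f z). split; auto. now apply is_poly_scal.
  - now apply is_poly_S, is_poly_scal.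
Qed.

Lemma is_poly_sub_factor (n : nat) (f : R -> R) (a : R) : is_poly (S n) f ->
  exists g, is_poly n g /\ forall z, f z - f a = (z - a) * g z.
Proof.
  revert f. induction n as [|n IH]; intros f (c & g & Hg & H).
  - exists g. split; auto. destruct Hg as [d Hd]. intros z. rewrite !H, !Hd. ring.
  - destruct (IH g Hg) as (h & Hh & E). exists (fun z => g a + z * h z). split.
    + exists (g a), h. split; auto.
    + intros z. rewrite !H.
      replace (c + z * g z - (c + a * g a)) with ((z - a) * g a + z * (g z - g a)) by ring.
      rewrite E. ring.
Qed.

Fixpoint rprod (f : nat -> R) (n : nat) : R :=
  match n with O => 1 | S k => rprod f k * f k end.

(** Each root splits off a linear factor, distinctness keeps the other roots in the quotient, and
    after [n] divisions a constant is left. *)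
Lemma is_poly_roots (n : nat) (f : R -> R) (a : nat -> R) : is_poly n f ->
  (forall k, (k < n)%nat -> f (a k) = 0) ->
  (forall i j, (i < j < n)%nat -> a i <> a j) ->
  exists L, forall z, f z = L * rprod (fun k => z - a k) n.
Proof.
  revert f. induction n as [|n IH]; intros f Hf Hr Hd.
  - destruct Hf as [c H]. exists c. intros z. rewrite H. simpl. ring.
  - destruct (is_poly_sub_factor n f (a n) Hf) as (g & Hg & E).
    rewrite Hr in E by lia.
    destruct (IH g Hg) as [L HL].
    + intros k Hk. assert (F := E (a k)). rewrite Hr in F by lia.
      assert (N := Hd k n ltac:(lia)).
      apply Rmult_eq_reg_l with (a k - a n); lra.
    + intros; apply Hd; lia.
    + exists L. intros z. specialize (E z). rewrite HL in E. simpl.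
      rewrite <- (Rminus_0_r (f z)), E. ring.
Qed.

Lemma is_derive_rprod (a : nat -> R) (n : nat) (x : R) :
  (forall k, (k < n)%nat -> x <> a k) ->
  is_derive (fun z => rprod (fun k => z - a k) n) x
    (rprod (fun k => x - a k) n * rsum (fun k => / (x - a k)) n).
Proof.
  intros H. induction n as [|n IH].
  - simpl. rewrite Rmult_0_r. apply (is_derive_const (V := R_NormedModule)).
  - assert (Hn := H n ltac:(lia)). simpl. evar_last.
    { apply is_derive_Rmult.
      - apply IH. intros; apply H; lia.
      - apply (is_derive_shift (- a n)). }
    simpl. field. lra.
Qed.

(* psi_part with n terms, cleared of denominators by z (z + 1) ... (z + n - 1). *)
Fixpoint psi_num (n : nat) (z : R) : R :=
  match n with
  | O => - EulerGamma
  | S m => psi_num m z * (z + INR m) + rrising z m * ((z + INR m) / INR (S m) - 1)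
  end.

Lemma is_poly_rrising (n : nat) : is_poly n (fun z => rrising z n).
Proof.
  induction n as [|n IH].
  - now exists 1.
  - apply is_poly_ext with (2 := is_poly_mul_affine n 1 (INR n) _ IH).
    intros; simpl; ring.
Qed.

Lemma is_poly_psi_num (n : nat) : is_poly n (psi_num n).
Proof.
  induction n as [|n IH].
  - now exists (- EulerGamma).
  - assert (P1 := is_poly_mul_affine n 1 (INR n) _ IH).
    assert (P2 := is_poly_mul_affine n (/ INR (S n)) (INR n / INR (S n) - 1) _ (is_poly_rrising n)).
    apply is_poly_ext with (2 := is_poly_plus _ _ _ P1 P2).
    intros z. cbv beta.
    change (psi_num (S n) z)
      with (psi_num n z * (z + INR n) + rrising z n * ((z + INR n) / INR (S n) - 1)).
    unfold Rdiv. ring.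
Qed.

Lemma psi_num_eq (n : nat) (z : R) : real_domain z ->
  psi_num n z = rrising z n * (- EulerGamma + rsum (psi_term z) n).
Proof.
  intros H. induction n as [|n IH].
  - simpl. ring.
  - change (psi_num (S n) z)
      with (psi_num n z * (z + INR n) + rrising z n * ((z + INR n) / INR (S n) - 1)).
    rewrite IH. simpl rrising. simpl rsum. unfold psi_term.
    assert (Hn := H n). field. split. lra. apply not_0_INR; lia.
Qed.

(** This is H_n, so [harm (S n)] equals [harmonic n]. *)
Definition harm (n : nat) : R := rsum (fun k => / INR (S k)) n.

Definition zeta2 (n : nat) : R := rsum (fun k => / INR (S k) ^ 2) n.

Lemma harm_S (n : nat) : harm (S n) = harm n + / INR (S n).
Proof. reflexivity. Qed.

Lemma zeta2_S (n : nat) : zeta2 (S n) = zeta2 n + / INR (S n) ^ 2.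
Proof. reflexivity. Qed.

Lemma rrising_S (z : R) (n : nat) : rrising z (S n) = rrising z n * (z + INR n).
Proof. reflexivity. Qed.

Lemma psi_num_S (n : nat) (z : R) : psi_num (S n) z =
  psi_num n z * (z + INR n) + rrising z n * ((z + INR n) / INR (S n) - 1).
Proof. reflexivity. Qed.

Lemma real_domain_1 : real_domain 1.
Proof. intros n E. assert (P := pos_INR n). lra. Qed.

(** [rrising 1 n] is n!, the scale of the values and derivatives of [psi_num] at 0 and 1. *)
Lemma rrising_1_derive (n : nat) :
  rrising 1 n <> 0 /\ is_derive (fun z => rrising z n) 1 (rrising 1 n * harm n).
Proof.
  split. apply rrising_neq_0, real_domain_1.
  replace (harm n) with (pole_sum 1 n). apply is_derive_rrising, real_domain_1.
  induction n as [|n IH]; auto. rewrite harm_S, <- IH, S_INR, (Rplus_comm (INR n)). reflexivity.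
Qed.

Lemma is_derive_psi_num_S (n : nat) (z dp dr : R) :
  is_derive (psi_num n) z dp -> is_derive (fun y => rrising y n) z dr ->
  is_derive (psi_num (S n)) z
    (dp * (z + INR n) + psi_num n z
     + (dr * ((z + INR n) / INR (S n) - 1) + rrising z n / INR (S n))).
Proof.
  intros Hp Hr.
  assert (D1 : is_derive (fun y => psi_num n y * (y + INR n)) z (dp * (z + INR n) + psi_num n z * 1)).
  { apply (is_derive_Rmult (psi_num n) (fun y => y + INR n)); auto.
    apply is_derive_shift. }
  assert (D0 : is_derive (fun y => (y + INR n) / INR (S n) - 1) z (/ INR (S n))).
  { generalize (not_0_INR (S n) ltac:(lia)). generalize (INR (S n)). intros c Hc.
    auto_derive; auto. field; auto. }
  assert (D2 : is_derive (fun y => rrising y n * ((y + INR n) / INR (S n) - 1)) z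
    (dr * ((z + INR n) / INR (S n) - 1) + rrising z n * / INR (S n))).
  { apply (is_derive_Rmult (fun y => rrising y n) (fun y => (y + INR n) / INR (S n) - 1)); auto. }
  assert (D := is_derive_plus (V := R_NormedModule) _ _ _ _ _ D1 D2).
  unfold plus in D; simpl in D. rewrite Rmult_1_r in D. exact D.
Qed.

(** At 1 each [psi_term] vanishes and has derivative 1/(n + 1)^2, which is where [zeta2] comes
    from. *)
Lemma psi_num_at_1 (n : nat) : psi_num n 1 = - EulerGamma * rrising 1 n /\
  is_derive (psi_num n) 1 (rrising 1 n * (- EulerGamma * harm n + zeta2 n)).
Proof.
  induction n as [|n [E D]].
  - split. simpl; ring. change (zeta2 0) with 0. change (harm 0) with 0. simpl.
    replace (1 * (- EulerGamma * 0 + 0)) with 0 by ring.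
    apply (is_derive_const (V := R_NormedModule)).
  - assert (Hn : INR (S n) <> 0) by (apply not_0_INR; lia).
    assert (Hn' : 1 + INR n = INR (S n)) by (rewrite S_INR; ring).
    split.
    + rewrite psi_num_S, rrising_S, E, Hn'. field; auto.
    + destruct (rrising_1_derive n) as [_ Dr].
      evar_last. apply (is_derive_psi_num_S n 1 _ _ D Dr).
      rewrite zeta2_S, harm_S, rrising_S, E, Hn'. field; auto.
Qed.

Lemma rrising_at_0 (n : nat) : rrising 0 (S n) = 0 /\
  is_derive (fun z => rrising z (S n)) 0 (rrising 1 n).
Proof.
  assert (E : forall z, rrising z (S n) = z * rrising (z + 1) n).
  { intros z. induction n as [|n IH]. simpl; ring.
    rewrite rrising_S, IH, rrising_S, S_INR. ring. }
  split. rewrite E; ring.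
  apply is_derive_ext with (fun z => z * rrising (z + 1) n). intros; now rewrite E.
  evar_last.
  { apply (is_derive_Rmult (fun z => z) (fun z => rrising (z + 1) n) 0 1).
    - apply (is_derive_id (K := R_AbsRing)).
    - apply (is_derive_comp (fun z => rrising z n) (fun z => z + 1)).
      + rewrite Rplus_0_l. apply rrising_1_derive.
      + apply is_derive_shift. }
  cbv beta. rewrite Rplus_0_l. ring.
Qed.

(** 0 is a pole, outside the range of [psi_num_eq]. With the pole cleared, [psi_num (S n)] is (z +
    1)...(z + n) times -1 + z (1 - gamma + sum_(1 <= j <= n) (1/(j+1) - 1/(z+j))), and at 0 the
    inner sum telescopes to 1/(n+1) - 1. *)
Lemma psi_num_at_0 (n : nat) : psi_num (S n) 0 = - rrising 1 n /\
  is_derive (psi_num (S n)) 0 (- rrising 1 n * (EulerGamma - / INR (S n) + harm n)).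
Proof.
  induction n as [|n [E D]].
  - split. simpl; field. 
    apply is_derive_ext with (fun z => - EulerGamma * z + (z - 1)).
    intros; simpl; field. change (harm 0) with 0. auto_derive; auto. simpl. field.
  - assert (Hn : INR (S n) <> 0) by (apply not_0_INR; lia).
    assert (Pn := pos_INR n).
    destruct (rrising_at_0 n) as [R0 Dr].
    split.
    + rewrite psi_num_S, E, R0, rrising_S, S_INR. ring.
    + evar_last. apply (is_derive_psi_num_S (S n) 0 _ _ D Dr).
      rewrite E, R0, rrising_S, harm_S, !S_INR. field. lra.
Qed.

Lemma log_derive_roots (n : nat) (f : R -> R) (a : nat -> R) (x d : R) :
  is_poly n f -> (forall k, (k < n)%nat -> f (a k) = 0) ->
  (forall i j, (i < j < n)%nat -> a i <> a j) ->
  is_derive f x d -> f x <> 0 -> d = f x * rsum (fun k => / (x - a k)) n.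
Proof.
  intros Hp Hr Hd HD Hx.
  destruct (is_poly_roots n f a Hp Hr Hd) as [L HL].
  assert (Hne : forall k, (k < n)%nat -> x <> a k).
  { intros k Hk E. apply Hx. rewrite E. now apply Hr. }
  assert (D : is_derive f x (L * (rprod (fun k => x - a k) n * rsum (fun k => / (x - a k)) n))).
  { apply is_derive_ext with (fun z => L * rprod (fun k => z - a k) n).
    intros; now rewrite HL.
    apply (is_derive_scal (fun z => rprod (fun k => z - a k) n) x L). now apply is_derive_rprod. }
  apply is_derive_unique in HD. apply is_derive_unique in D.
  rewrite HL. rewrite <- HD, D. ring.
Qed.

(** In [S0 - S1], H_N - H_(N+1) leaves - 1/(N+1), which joins the - 1/(N+1) from the derivative at
    0. *)
Lemma psi_part_zero_sum (N : nat) (a : nat -> R) :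
  (forall k, (k <= N)%nat -> cell k (a k) /\ psi_part N (a k) = 0) ->
  rsum (fun k => 1 / (a k ^ 2 - a k)) (S N)
    = EulerGamma - 2 / INR (S N) + zeta2 (S N) / EulerGamma.
Proof.
  intros Ha. assert (G := EulerGamma_bounds).
  assert (Hr : forall k, (k < S N)%nat -> psi_num (S N) (a k) = 0).
  { intros k Hk. destruct (Ha k ltac:(lia)) as [H1 H2].
    rewrite psi_num_eq by (eapply cell_real_domain; eauto).
    rewrite <- psi_part_rsum, H2. ring. }
  assert (Hd : forall i j, (i < j < S N)%nat -> a i <> a j).
  { intros i j H. destruct (Ha i ltac:(lia)) as [H1 _]. destruct (Ha j ltac:(lia)) as [H2 _].
    assert (A := cell_lt i j _ _ ltac:(lia) H1 H2). lra. }
  destruct (psi_num_at_1 (S N)) as [E1 D1]. destruct (psi_num_at_0 N) as [E0 D0].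
  destruct (rrising_1_derive (S N)) as [N1 _]. destruct (rrising_1_derive N) as [N0 _].
  assert (L1 := log_derive_roots _ _ a 1 _ (is_poly_psi_num (S N)) Hr Hd D1
    ltac:(rewrite E1; apply Rmult_integral_contrapositive; split; auto; lra)).
  assert (L0 := log_derive_roots _ _ a 0 _ (is_poly_psi_num (S N)) Hr Hd D0 ltac:(rewrite E0; lra)).
  rewrite E1 in L1. rewrite E0 in L0.
  set (S1 := rsum (fun k => / (1 - a k)) (S N)) in *.
  set (S0 := rsum (fun k => / (0 - a k)) (S N)) in *.
  assert (Hne : forall k, (k < S N)%nat -> a k <> 0 /\ a k <> 1).
  { intros k Hk. destruct (Ha k ltac:(lia)) as [H1 H2]. split.
    - intros E. rewrite E in H1. apply (cell_real_domain k 0 H1 O). simpl; ring.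
    - intros E. rewrite E, psi_part_1 in H2. lra. }
  assert (ES : rsum (fun k => 1 / (a k ^ 2 - a k)) (S N) = S0 + -1 * S1).
  { unfold S0, S1. rewrite <- rsum_scal, <- rsum_plus. apply rsum_ext. intros k Hk.
    destruct (Hne k Hk). field. repeat split; try lra.
    replace (a k ^ 2 - a k) with (a k * (a k - 1)) by ring.
    apply Rmult_integral_contrapositive; split; lra. }
  assert (V0 : S0 = EulerGamma - / INR (S N) + harm N).
  { apply Rmult_eq_reg_l with (- rrising 1 N); lra. }
  assert (V1 : S1 = harm (S N) - zeta2 (S N) / EulerGamma).
  { apply Rmult_eq_reg_l with (- EulerGamma * rrising 1 (S N)).
    rewrite <- L1. field. lra.
    apply Rmult_integral_contrapositive; split; auto; lra. }
  rewrite ES, V0, V1, harm_S. unfold Rdiv. ring.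
Qed.

(** * Passage to the limit *)

Lemma psi_term_eq (z : R) (n : nat) : z + INR n <> 0 ->
  psi_term z n = (z - 1) * / ((INR n + 1) * (z + INR n)).
Proof.
  intros H. unfold psi_term. rewrite S_INR. assert (P := pos_INR n). field. lra.
Qed.

Lemma psi_part_S (N : nat) (z : R) : psi_part (S N) z = psi_part N z + psi_term z (S N).
Proof. rewrite !psi_part_rsum. simpl rsum. ring. Qed.

Lemma psi_term_tail (k n : nat) (x : R) : cell k x -> (k <= n)%nat ->
  0 < / ((INR n + 1) * (x + INR n)).
Proof.
  intros Hx Hn. assert (A := cell_pos k n x Hx Hn). assert (P := pos_INR n).
  apply Rinv_0_lt_compat, Rmult_lt_0_compat; lra.
Qed.

(** By [psi_term_eq] the terms beyond [N] have the sign of x - 1, since x + n > 0 there. *)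
Lemma Psi_le_psi_part (k N : nat) (x : R) : cell k x -> (k <= N)%nat -> x < 1 ->
  Psi x <= psi_part N x.
Proof.
  intros Hx HN H1.
  assert (L := proj1 (is_lim_seq_incr_n _ N _) (is_lim_Psi x (cell_real_domain k x Hx))) .
  apply (is_lim_seq_le _ (fun _ => psi_part N x) (Finite (Psi x)) (Finite (psi_part N x)))
    with (2 := L) (3 := is_lim_seq_const _).
  induction n as [|n IH]. simpl; lra.
  simpl. rewrite psi_part_S, psi_term_eq by (eapply cell_neq; eauto).
  assert (A := psi_term_tail k (S (n + N)) x Hx ltac:(lia)). nra.
Qed.

Lemma Psi_ge_psi_part (N : nat) (x : R) : 1 < x -> psi_part N x <= Psi x.
Proof.
  intros H1. assert (Hx := cell_0 x ltac:(lra)).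
  assert (L := proj1 (is_lim_seq_incr_n _ N _) (is_lim_Psi x (cell_real_domain 0 x Hx))) .
  apply (is_lim_seq_le (fun _ => psi_part N x) _ (Finite (psi_part N x)) (Finite (Psi x)))
    with (2 := is_lim_seq_const _) (3 := L).
  induction n as [|n IH]. simpl; lra.
  simpl. rewrite psi_part_S, psi_term_eq by (eapply cell_neq; eauto).
  assert (A := psi_term_tail 0 (S (n + N)) x Hx ltac:(lia)). nra.
Qed.

Lemma Psi_incr (k : nat) (a b : R) : cell k a -> cell k b -> a < b -> Psi a < Psi b.
Proof. apply (cell_steep_incr k k). intros x y. apply Psi_diff_ge. Qed.

Lemma Psi_lt_inv (k : nat) (a b : R) : cell k a -> cell k b -> Psi a < Psi b -> a < b.
Proof. apply (cell_steep_lt_inv k k). intros x y. apply Psi_diff_ge. Qed.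

Lemma psi_part_lt_inv (k N : nat) (a b : R) : (k <= N)%nat -> cell k a -> cell k b ->
  psi_part N a < psi_part N b -> a < b.
Proof.
  intros Hk. apply (cell_steep_lt_inv k k). intros x y Hx Hy H.
  now apply (psi_part_diff_ge k).
Qed.

Definition zero_term (x : R) : R := 1 / (x ^ 2 - x).

Lemma term_le (a b : R) : (a <= b < 0 \/ 1 < b <= a) -> 0 <= zero_term a <= zero_term b.
Proof.
  intros H. unfold zero_term, Rdiv. rewrite !Rmult_1_l. split.
  - apply Rlt_le, Rinv_0_lt_compat. nra.
  - apply Rinv_le_contravar; nra.
Qed.

Lemma continuous_term (x : R) : x < 0 \/ 1 < x -> continuous zero_term x.
Proof.
  intros H. apply (ex_derive_continuous zero_term). unfold zero_term. auto_derive. nra.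
Qed.

(** By strong induction: alpha_k cannot lie in an earlier cell, whose only zero is an earlier alpha,
    nor in a later one, since the larger zero of cell [k] would then be missed by the decreasing
    enumeration. *)
Lemma strict_enum_cells (alpha : nat -> R) :
  (forall k, alpha (S k) < alpha k) ->
  (forall x, real_domain x /\ Psi x = 0 <-> exists k, x = alpha k) ->
  forall k, cell k (alpha k).
Proof.
  intros Hdec Hz.
  assert (Hlt : forall i j, (i < j)%nat -> alpha j < alpha i).
  { intros i j H. induction H; auto. specialize (Hdec m). lra. }
  assert (Huniq : forall k x y, cell k x -> cell k y -> Psi x = 0 -> Psi y = 0 -> x = y).
  { intros k x y Hx Hy Ex Ey. destruct (Rtotal_order x y) as [H|[H|H]]; auto.
    - assert (A := Psi_incr k x y Hx Hy H). lra.
    - assert (A := Psi_incr k y x Hy Hx H). lra. }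
  assert (Hzero : forall k, Psi (alpha k) = 0) by (intros k; apply Hz; eauto).
  intros k. induction k as [k IH] using (well_founded_induction Wf_nat.lt_wf).
  destruct (ex_Psi_zero k) as (b & Hb & Eb).
  destruct (proj1 (Hz b)) as [j ->].
  { split; auto. eapply cell_real_domain; eauto. }
  destruct (Nat.lt_trichotomy j k) as [H|[->|H]]; auto.
  - assert (A := cell_lt j k _ _ H (IH j H) Hb). lra.
  - destruct (ex_cell (alpha k)) as [i Hi]. { apply (Hz (alpha k)). eauto. }
    assert (A := Hlt k j H).
    destruct (Nat.lt_trichotomy i k) as [Hik|[->|Hik]]; auto.
    + assert (B := Huniq i _ _ (IH i Hik) Hi (Hzero i) (Hzero k)).
      specialize (Hlt i k Hik). lra.
    + assert (B := cell_lt k i _ _ Hik Hb Hi). lra.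
Qed.

Lemma finite_choice (n : nat) (P : nat -> R -> Prop) :
  (forall k, (k < n)%nat -> exists x, P k x) ->
  exists a : nat -> R, forall k, (k < n)%nat -> P k (a k).
Proof.
  induction n as [|n IH]; intros H.
  - exists (fun _ => 0). intros; lia.
  - destruct IH as [a Ha]. { intros; apply H; lia. }
    destruct (H n ltac:(lia)) as [x Hx].
    exists (fun k => if Nat.eqb k n then x else a k). intros k Hk.
    destruct (Nat.eqb_spec k n) as [->|]; auto. apply Ha; lia.
Qed.

Definition zero_enum (alpha : nat -> R) : Prop :=
  forall k, cell k (alpha k) /\ Psi (alpha k) = 0.

Lemma zero_enum_0_gt_1 (alpha : nat -> R) : zero_enum alpha -> 1 < alpha O.
Proof.
  intros Ha. destruct (Ha O) as [Hc Hz].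
  assert (G := EulerGamma_bounds).
  apply (Psi_lt_inv 0); auto. apply cell_0; lra. rewrite Psi_1, Hz. lra.
Qed.

Lemma approx_term_le (alpha : nat -> R) (N k : nat) (x : R) : zero_enum alpha -> (k <= N)%nat -> cell k x -> psi_part N x = 0 ->
  0 <= zero_term x <= zero_term (alpha k).
Proof.
  intros Ha Hk Hx Ex. apply term_le. destruct (Ha k) as [Hc Hz].
  assert (H01 := zero_enum_0_gt_1 alpha Ha).
  destruct k as [|k].
  - right. split. exact H01.
    apply Rnot_lt_le. intros H.
    assert (A := Psi_ge_psi_part N (alpha O) H01). rewrite Hz in A.
    assert (B := cell_steep_incr 0 0 (psi_part N) x (alpha O)
      (fun a b Ha Hb Hab => psi_part_diff_ge 0 N 0 a b Ha Hb Hab Hk) Hx Hc H). lra.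
  - assert (A1 := cell_S_neg k _ Hc).
    left. split; auto.
    apply Rnot_lt_le. intros H.
    assert (A := Psi_le_psi_part (S k) N (alpha (S k)) Hc Hk ltac:(lra)). rewrite Hz in A.
    assert (B := cell_steep_incr (S k) (S k) (psi_part N) (alpha (S k)) x
      (fun a b Ha Hb Hab => psi_part_diff_ge (S k) N (S k) a b Ha Hb Hab Hk) Hc Hx H). lra.
Qed.

(** At a point just beyond alpha_k, on the side away from [0, 1], [Psi] has a strict sign which the
    truncations eventually share. Their zero then lies closer to [0, 1] than this point, so its
    [zero_term] is at least as large. *)
Lemma approx_term_ge (alpha : nat -> R) (k : nat) (eps : R) : zero_enum alpha -> 0 < eps ->
  exists N0, forall N x, (N0 <= N)%nat -> cell k x -> psi_part N x = 0 ->
    zero_term (alpha k) - eps <= zero_term x.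
Proof.
  intros Ha Heps. destruct (Ha k) as [Hc Hz].
  assert (H01 := zero_enum_0_gt_1 alpha Ha).
  assert (Hr : alpha k < 0 \/ 1 < alpha k).
  { destruct k. right; exact H01. left; now apply (cell_S_neg k). }
  assert (Hcont := continuous_term _ Hr).
  destruct (Hcont (fun v => zero_term (alpha k) - eps < v)) as [d1 Hd1].
  { exists (mkposreal eps Heps). intros v Hv. apply Rabs_def2 in Hv.
    unfold minus, plus, opp in Hv; simpl in Hv. lra. }
  destruct (cell_open k _ Hc) as (d2 & Hd2 & Ho).
  set (d := Rmin d1 d2 / 2).
  assert (M1 := Rmin_l d1 d2). assert (M2 := Rmin_r d1 d2).
  assert (M3 : 0 < Rmin d1 d2) by (apply Rmin_glb_lt; auto; apply cond_pos).
  assert (Hnear : forall y, Rabs (y - alpha k) <= d -> cell k y /\ zero_term (alpha k) - eps < zero_term y).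
  { intros y Hy. split. apply Ho; unfold d in Hy; lra.
    apply Hd1. unfold ball; simpl. unfold AbsRing_ball, abs, minus, plus, opp; simpl.
    change (Rabs (y - alpha k) < d1). unfold d in Hy; lra. }
  destruct k as [|k].
  - destruct (Hnear (alpha O + d)) as [Cy Ty].
    { replace (alpha O + d - alpha O) with d by ring. rewrite Rabs_pos_eq; unfold d; lra. }
    assert (Py : 0 < Psi (alpha O + d)).
    { rewrite <- Hz. apply (Psi_incr 0); auto. unfold d; lra. }
    assert (L := is_lim_Psi _ (cell_real_domain _ _ Cy)). apply is_lim_seq_spec in L.
    destruct (L (mkposreal _ Py)) as [N0 HN]. exists N0. intros N x HN0 Hx Ex.
    specialize (HN N HN0). simpl in HN. apply Rabs_def2 in HN.
    assert (x < alpha O + d) by (apply (psi_part_lt_inv 0 N); auto; [lia | lra]).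
    assert (H1 : 1 < x).
    { apply (psi_part_lt_inv 0 N); auto. lia. apply cell_0; lra.
      assert (G := EulerGamma_bounds). rewrite psi_part_1. lra. }
    destruct (term_le (alpha O + d) x) as [_ T]. right; lra. lra.
  - destruct (Hnear (alpha (S k) - d)) as [Cy Ty].
    { replace (alpha (S k) - d - alpha (S k)) with (- d) by ring.
      rewrite Rabs_Ropp, Rabs_pos_eq; unfold d; lra. }
    assert (Py : 0 < - Psi (alpha (S k) - d)).
    { assert (Psi (alpha (S k) - d) < Psi (alpha (S k))).
      { apply (Psi_incr (S k)); auto. unfold d; lra. }
      rewrite Hz in H. lra. }
    assert (L := is_lim_Psi _ (cell_real_domain _ _ Cy)). apply is_lim_seq_spec in L.
    (* Adding [S k] keeps the pole at the left end of the cell in the truncation, as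
       [psi_part_lt_inv] requires. *)
    destruct (L (mkposreal _ Py)) as [N0 HN]. exists (N0 + S k)%nat. intros N x HN0 Hx Ex.
    specialize (HN N ltac:(lia)). simpl in HN. apply Rabs_def2 in HN.
    assert (alpha (S k) - d < x) by (apply (psi_part_lt_inv (S k) N); auto; [lia | lra]).
    assert (x < 0) by now apply (cell_S_neg k).
    destruct (term_le (alpha (S k) - d) x) as [_ T]. left; lra. lra.
Qed.

Lemma approx_sum_ge (alpha : nat -> R) (K : nat) (eps : R) : zero_enum alpha -> 0 < eps ->
  exists N0, forall N (a : nat -> R), (N0 <= N)%nat ->
    (forall k, (k < K)%nat -> cell k (a k) /\ psi_part N (a k) = 0) ->
    rsum (fun k => zero_term (alpha k)) K - INR K * eps <= rsum (fun k => zero_term (a k)) K.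
Proof.
  intros Hal Heps. induction K as [|K [N1 H1]].
  - exists O. intros; simpl; lra.
  - destruct (approx_term_ge alpha K eps Hal Heps) as [N2 H2]. exists (N1 + N2)%nat.
    intros N a HN Ha.
    assert (A := H1 N a ltac:(lia) (fun k Hk => Ha k ltac:(lia))).
    destruct (Ha K ltac:(lia)) as [C E].
    assert (B := H2 N (a K) ltac:(lia) C E). rewrite S_INR. simpl rsum. lra.
Qed.

Definition approx_value (N : nat) : R :=
  EulerGamma - 2 / INR (S N) + zeta2 (S N) / EulerGamma.

(** The threshold comes from cell 0: [psi_part N 2] tends to 1 - gamma > 0. *)
Lemma ex_approx_zeros : exists N0, forall N, (N0 <= N)%nat -> exists a : nat -> R,
  forall k, (k < S N)%nat -> cell k (a k) /\ psi_part N (a k) = 0.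
Proof.
  assert (G := EulerGamma_bounds).
  assert (L := is_lim_Psi 2 (cell_real_domain 0 2 (cell_0 2 ltac:(lra)))).
  apply is_lim_seq_spec in L. rewrite Psi_2 in L.
  assert (P : 0 < 1 - EulerGamma) by lra.
  destruct (L (mkposreal _ P)) as [N0 HN]. exists N0. intros N H.
  specialize (HN N H). simpl in HN. apply Rabs_def2 in HN.
  apply (finite_choice (S N) (fun k x => cell k x /\ psi_part N x = 0)).
  intros k Hk. apply ex_psi_part_zero; [lia | lra].
Qed.

Lemma is_lim_approx_value :
  is_lim_seq approx_value (EulerGamma + PI ^ 2 / (6 * EulerGamma)).
Proof.
  assert (G := EulerGamma_bounds).
  assert (L1 := is_lim_seq_inv_shift 2 1).
  assert (L2 := proj1 (is_lim_seq_incr_1 _ _) Basel).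
  assert (L3 : is_lim_seq (fun n => zeta2 (S n) * / EulerGamma) (PI ^ 2 / 6 * / EulerGamma))
    by exact (is_lim_seq_scal_r _ (/ EulerGamma) _ L2).
  assert (L := is_lim_seq_plus' _ _ _ _ (is_lim_seq_minus' _ _ _ _ (is_lim_seq_const EulerGamma) L1) L3).
  replace (EulerGamma + PI ^ 2 / (6 * EulerGamma))
    with (EulerGamma - 0 + PI ^ 2 / 6 * / EulerGamma) by (field; lra).
  apply is_lim_seq_ext with (2 := L). intros n. unfold approx_value.
  rewrite S_INR, (Rplus_comm (INR n)). reflexivity.
Qed.

Lemma zero_enum_sum_ge (alpha : nat -> R) (N : nat) (a : nat -> R) : zero_enum alpha ->
  (forall k, (k < S N)%nat -> cell k (a k) /\ psi_part N (a k) = 0) ->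
  approx_value N <= rsum (fun k => zero_term (alpha k)) (S N).
Proof.
  intros Hal Ha. unfold approx_value.
  rewrite <- (psi_part_zero_sum N a) by (intros k Hk; apply Ha; lia).
  apply rsum_le. intros k Hk. destruct (Ha k Hk). apply (approx_term_le alpha N k); auto; lia.
Qed.

(** Fix [K] and let [N] grow: the first [K] truncated terms come within [eps] of those of [alpha],
    the others are nonnegative, and all together sum to [approx_value N]. *)
Lemma zero_enum_sum_le (alpha : nat -> R) (K : nat) : zero_enum alpha ->
  rsum (fun k => zero_term (alpha k)) K <= EulerGamma + PI ^ 2 / (6 * EulerGamma).
Proof.
  intros Hal. apply le_epsilon. intros e He.
  set (eps := e / (INR K + 1)). assert (PK := pos_INR K).
  assert (Heps : 0 < eps) by (apply Rdiv_lt_0_compat; lra).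
  assert (HK : INR K * eps <= e).
  { replace e with ((INR K + 1) * eps) at 1 by (unfold eps; field; lra). nra. }
  destruct (approx_sum_ge alpha K eps Hal Heps) as [N1 H1].
  destruct ex_approx_zeros as [N2 H2].
  assert (A : rsum (fun k => zero_term (alpha k)) K - INR K * eps
      <= EulerGamma + PI ^ 2 / (6 * EulerGamma)); [|lra].
  apply (is_lim_seq_le_loc (fun _ => rsum (fun k => zero_term (alpha k)) K - INR K * eps) approx_value
     (Finite _) (Finite _)) with (2 := is_lim_seq_const _) (3 := is_lim_approx_value).
  exists (N1 + N2 + K)%nat. intros N HN.
  destruct (H2 N ltac:(lia)) as [a Ha].
  eapply Rle_trans. apply (H1 N a). lia. intros k Hk; apply Ha; lia.
  unfold approx_value. rewrite <- (psi_part_zero_sum N a) by (intros k Hk; apply Ha; lia).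
  change (fun k => 1 / (a k ^ 2 - a k)) with (fun k => zero_term (a k)).
  replace (S N) with (K + (S N - K))%nat by lia. rewrite rsum_add.
  assert (B : 0 <= rsum (fun k => zero_term (a (K + k)%nat)) (S N - K)); [|lra].
  rewrite <- (Rmult_0_r (INR (S N - K))), <- rsum_const.
  apply rsum_le. intros k Hk. destruct (Ha (K + k)%nat ltac:(lia)).
  apply (approx_term_le alpha N (K + k)); auto; lia.
Qed.

(** The partial sums are squeezed between [approx_value] and its limit. *)
Lemma is_series_zero_enum (alpha : nat -> R) : zero_enum alpha ->
  is_series (fun k => zero_term (alpha k)) (EulerGamma + PI ^ 2 / (6 * EulerGamma)).
Proof.
  intros Hal. destruct ex_approx_zeros as [N0 H0].
  apply (is_lim_seq_le_le_loc approx_value (sum_n (fun k => zero_term (alpha k)))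
    (fun _ => EulerGamma + PI ^ 2 / (6 * EulerGamma)) (Finite _)).
  - exists N0. intros n Hn. destruct (H0 n Hn) as [a Ha]. rewrite rsum_sum_n. split.
    + now apply (zero_enum_sum_ge alpha n a).
    + now apply zero_enum_sum_le.
  - apply is_lim_approx_value.
  - apply is_lim_seq_const.
Qed.

Theorem mainTheorem2 :
  forall alpha : nat -> R,
    (forall k : nat, alpha (S k) < alpha k) ->
    (forall z : C, is_Digamma_zero z <-> exists k : nat, z = RtoC (alpha k)) ->
    is_series (fun k : nat => 1 / (alpha k ^ 2 - alpha k))
              (EulerGamma + PI ^ 2 / (6 * EulerGamma)).
Proof.
  intros alpha Hdec Hz.
  assert (Hz' : forall x, real_domain x /\ Psi x = 0 <-> exists k, x = alpha k).
  { intros x. transitivity (is_Digamma_zero (RtoC x)).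
    - rewrite is_Digamma_zero_RtoC. split; intros [H1 H2]; split; auto.
      + rewrite <- H2. now apply is_lim_Psi.
      + unfold Psi. now rewrite (is_lim_seq_unique _ _ H2).
    - rewrite Hz. split; intros [k Hk]; exists k.
      + now apply RtoC_inj.
      + now rewrite Hk. }
  apply (is_series_zero_enum alpha). intros k. split.
  - now apply strict_enum_cells.
  - apply Hz'. eauto.
Qed.
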